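(* Suppose that the data are forward-Lipschitz and backward-regular (terms defined in the context). Let $L\in\mathcal V$, let $X$ be the solution of the forward equation with input $L$, let $(Y,Z,A)$ be the solution of the reflected BSDE with input $L$, and set $\xi_t:=h(t,X_t,\mathbb E[\int_{0^-}^T\phi(t-s)dL_s])$. Fix $t\in[0,T]$, let $\mathcal V_t=\{\hat L\in\mathcal V:\hat L_{t^-}=1\}$, and for $\hat L\in\mathcal V_t$ put $$\Lambda_t(L,\hat L):=\mathbb E\bigg[\int_t^Tf(s,X_s,\mathbb E[\bar f(s,X_s)L_s])\hat L_s\,ds-\int_{t^-}^T\xi_s\,d\hat L_s\,\bigg|\,\mathcal F_t\bigg].$$ Let $Y$ satisfy the representation $Y_t=\operatorname{ess\,sup}_{\hat L\in\mathcal V_t}\Lambda_t(L,\hat L)$ a.s. Then a process $\hat L\in\mathcal V_t$ is optimal, i.e. $Y_t=\Lambda_t(L,\hat L)$ a.s., if and only if $$\int_{t^-}^T(Y_s-\xi_s)\,d\hat L_s=0\qquad\text{and}\qquad\int_{t^-}^TA^t_s\,d\hat L_s=0\quad\text{a.s.},$$ where $A^t_s:=A_s-A_t$ for $s\ge t$.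
   Context: Fix $T>0$, integers $d,k,m\ge1$ and a real $q\ge4$. $(\Omega,\mathcal F,\mathbb P)$ is a complete probability space carrying a standard $m$-dimensional Brownian motion $W$ and a random variable $X_0:\Omega\to\mathbb R^d$ independent of $W$ with $\mathbb E[|X_0|^q]<\infty$; $\{\mathcal F_t\}_{t\in[0,T]}$ is the filtration generated by $X_0$ and $W$, augmented with all $\mathbb P$-null sets. Spaces (of equivalence classes; vector dimension clear from use): $\mathbb S^2$ = adapted continuous processes with $\mathbb E[\sup_{t}|Y_t|^2]<\infty$; $\mathbb H^2$ = progressively measurable processes with $\mathbb E[\int_0^T|Z_t|^2dt]<\infty$; $\mathbb A^2$ = real-valued non-decreasing processes $A\in\mathbb S^2$ with $A_0=0$; $\mathcal V\subset\mathbb H^2(\mathbb R)$ = classes admitting a representative $L$ that is $[0,1]$-valued, adapted, non-increasing, càdlàg with $L_T=0$. We set $L_{0^-}:=1$ and always use this representative. Integrals $\int_{t^-}^T\cdot\,dL_s$ include the jump $L_t-L_{t^-}$ at time $t$ (integrands take at $t^-$ their value at $t$). Data: measurable functions $b:[0,T]\times\mathbb R^d\times\mathbb R^k\to\mathbb R^d$, $\bar b:[0,T]\times\mathbb R^d\to\mathbb R^k$, $\sigma:[0,T]\times\mathbb R^d\times\mathbb R^k\to\mathbb R^{d\times m}$, $\bar\sigma:[0,T]\times\mathbb R^d\to\mathbb R^k$, $f:[0,T]\times\mathbb R^d\times\mathbb R^k\to\mathbb R$, $\bar f:[0,T]\times\mathbb R^d\to\mathbb R^k$, $h:[0,T]\times\mathbb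 R^d\times\mathbb R\to\mathbb R$, $\phi:[-T,T]\to\mathbb R$. The data are: - forward-Lipschitz if for some $K\ge0$: $|b(t,x,m)-b(t,x',m')|+|\sigma(t,x,m)-\sigma(t,x',m')|\le K(|x-x'|+|m-m'|)$, $|\bar b(t,x)-\bar b(t,x')|+|\bar\sigma(t,x)-\bar\sigma(t,x')|\le K|x-x'|$, $|b(t,0,0)|+|\sigma(t,0,0)|+|\bar b(t,0)|+|\bar\sigma(t,0)|\le K$ for all arguments; - backward-regular if for some $K\ge0$, $r\in[1,q/2)$: $|f(t,x,m')-f(t,x,m)|\le K|m'-m|$, $|f(t,x,0)|+|h(t,x,0)|+|\bar f(t,x)|\le K(1+|x|^r)$, $|h(t,x,w)-h(t,x,w')|\le K|w-w'|$ for all arguments, $h$ is jointly continuous and $\phi\in\mathcal C^1([-T,T])$. Forward equation with input $L\in\mathcal V$: $X_t=X_0+\int_0^tb(s,X_s,\mathbb E[\bar b(s,X_s)L_s])ds+\int_0^t\sigma(s,X_s,\mathbb E[\bar\sigma(s,X_s)L_s])dW_s$, $t\in[0,T]$. Reflected BSDE with input $L$: with $X$ the solution of the forward equation with input $L$ and $\xi$ as in the claim, find $(Y,Z,A)\in\mathbb S^2\times\mathbb H^2\times\mathbb A^2$ with $$Y_t=\xi_T+\int_t^Tf(s,X_s,\mathbb E[\bar f(s,X_s)L_s])ds+A_T-A_t-\int_t^T(Z_s,dW_s),\quad Y_t\ge\xi_t,\ 0\le t\le T,\quad\int_0^T(Y_t-\xi_t)dA_t=0.$$ For forward-Lipschitz,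 backward-regular data both problems have a unique solution for every $L\in\mathcal V$. *)

(* Defs.v *)
From HB Require Import structures.
From mathcomp Require Export all_boot all_order all_algebra.
From mathcomp Require Export all_classical all_reals all_analysis.

Set Implicit Arguments.
Unset Strict Implicit.
Unset Printing Implicit Defensive.

Import Order.TTheory GRing.Theory Num.Theory.
Import numFieldNormedType.Exports.

Local Open Scope classical_set_scope.
Local Open Scope ring_scope.

HB.instance Definition _ (R : realType) (a b : nat) :=
  Measurable.copy 'M[R]_(a, b) (g_sigma_algebraType (@open 'M[R]_(a, b))).

Section Vectors.
Context {R : realType}.

(* The norm provided by the library on matrices is the sup norm. *)
Definition enorm {a b : nat} (M : 'M[R]_(a, b)) : R :=
  Num.sqrt (\sum_(i < a) \sum_(j < b) M i j ^+ 2).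

Definition dotv {n : nat} (u v : 'rV[R]_n) : R := \sum_(j < n) u 0 j * v 0 j.

End Vectors.

Section Stieltjes.
Context {R : realType}.

Definition cumulative_of (F : R -> R)
    (ndF : {homo F : x y / x <= y}) (rcF : right_continuous F) :
  cumulative R R := HB.pack F (isCumulative.Build R _ R F ndF rcF).

(* Made total by the value [mzero]; it is only used for nondecreasing
   right-continuous [F]. *)
Definition stieltjes (F : R -> R) : {measure set (measurableTypeR R) -> \bar R} :=
  match pselect ({homo F : x y / x <= y} /\ right_continuous F) with
  | left H => lebesgue_stieltjes_measure (cumulative_of H.1 H.2)
  | right _ => mzero
  end.

(* Extension of a path given on [0, T] by its value 1 at 0- and by 0 after T,
   so that the jump at 0 is [l 0 - 1]. *)
Definition extL (T : R) (l : R -> R) (s : R) : R :=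
  if s < 0 then 1 else if s <= T then l s else 0.

(* The integral of g over [a, T], with the jump at a, against dl; l is
   nonincreasing, so - dl is the positive measure. *)
Definition intL (T a : R) (g l : R -> R) : R :=
  - \int[stieltjes (fun s => - extL T l s)]_(s in `[a, T]) g s.

(* The integral of g over [0, T] against da, for a nondecreasing continuous
   path a, extended by constants. *)
Definition intA (T : R) (g a : R -> R) : R :=
  \int[stieltjes (fun s => a (Num.max 0 (Num.min s T)))]_(s in `[0, T]) g s.

(* l_{t-}, with the convention l_{0-} = 1. *)
Definition left_limit (l : R -> R) (t : R) : R :=
  if 0 < t then lim (l s @[s --> t^'-]) else 1.

End Stieltjes.

Section Probability.
Context {R : realType} {dO : measure_display} {O : measurableType dO}.
Variable P : probability O R.

Definition indep (F G : set (set O)) : Prop :=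
  forall A B, F A -> G B -> (P (A `&` B) = P A * P B)%E.

(* V is a version of E[U | <<s G>>]. *)
Definition is_cond_exp (G : set (set O)) (U V : O -> R) : Prop :=
  [/\ P.-integrable setT (EFin \o U),
      measurable_fun setT (V : g_sigma_algebraType G -> R),
      P.-integrable setT (EFin \o V) &
      forall B, <<s G>> B -> \int[P]_(w in B) V w = \int[P]_(w in B) U w].

Definition is_ess_sup (S : set (O -> R)) (Y : O -> R) : Prop :=
  [/\ measurable_fun setT Y,
      forall V, S V -> {ae P, forall w, V w <= Y w} &
      forall U : O -> R, measurable_fun setT U ->
        (forall V, S V -> {ae P, forall w, V w <= U w}) ->
        {ae P, forall w, Y w <= U w}].

Definition past {m : nat} (W : R -> O -> 'rV[R]_m) (t : R) : set (set O) :=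
  \bigcup_(s in `[0, t]) preimage_set_system setT (W s) measurable.

Record brownian_motion (T : R) (m : nat) (W : R -> O -> 'rV[R]_m) : Prop := {
  bm_measurable : forall t, 0 <= t <= T -> measurable_fun setT (W t);
  bm_start : {ae P, forall w, W 0 w = 0};
  bm_continuous :
    {ae P, forall w, {within `[0, T], continuous (fun t => W t w)}};
  bm_independent : forall s t, 0 <= s -> s < t -> t <= T ->
    indep <<s past W s>>
      (preimage_set_system setT (fun w => W t w - W s w) measurable);
  (* increments are centred Gaussian with covariance (t - s) I_m *)
  bm_gaussian : forall s t, 0 <= s -> s < t -> t <= T ->
    forall B : 'I_m -> set R, (forall j, measurable (B j)) ->
    P [set w | forall j, B j ((W t w - W s w) 0 j)] =
    (\prod_(j < m) normal_prob 0 (Num.sqrt (t - s)) (B j))%E }.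

(* Generators of F_t : X0, W up to time t, and all P-null sets. *)
Definition filtration {d m : nat} (W : R -> O -> 'rV[R]_m) (X0 : O -> 'rV[R]_d)
    (t : R) : set (set O) :=
  preimage_set_system setT X0 measurable `|` past W t
    `|` [set N | P.-negligible N].

End Probability.

Section Processes.
Context {R : realType} {dO : measure_display} {O : measurableType dO}.
Variables (P : probability O R) (T : R).
(* [G t] generates the sigma-algebra F_t. *)
Variable G : R -> set (set O).

Definition adapted {dV : measure_display} {V : measurableType dV}
    (Y : R -> O -> V) : Prop :=
  forall t, 0 <= t <= T ->
    measurable_fun setT (Y t : g_sigma_algebraType (G t) -> V).

Definition progressive {dV : measure_display} {V : measurableType dV}
    (Y : R -> O -> V) : Prop :=
  forall t, 0 <= t <= T ->
    measurable_fun [set p : R * g_sigma_algebraType (G t) | 0 <= p.1 <= t]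
      (fun p : R * g_sigma_algebraType (G t) => Y p.1 p.2).

(* Elements of the spaces of equivalence classes are given by
   representatives whose path properties hold everywhere. *)
Definition S2 (Y : R -> O -> R) : Prop :=
  [/\ adapted Y,
      forall w, {within `[0, T], continuous (fun t => Y t w)} &
      (\int[P]_w ereal_sup [set ((Y t w) ^+ 2)%:E | t in `[0%R, T]] < +oo)%E].

Definition S2v {n : nat} (Y : R -> O -> 'rV[R]_n) : Prop :=
  [/\ adapted Y,
      forall w, {within `[0, T], continuous (fun t => Y t w)} &
      (\int[P]_w ereal_sup [set ((enorm (Y t w)) ^+ 2)%:E | t in `[0%R, T]]
        < +oo)%E].

Definition H2 {n : nat} (Z : R -> O -> 'rV[R]_n) : Prop :=
  progressive Z /\
  (\int[P]_w \int[lebesgue_measure]_(t in `[0%R, T])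
     ((enorm (Z t w)) ^+ 2)%:E < +oo)%E.

Definition A2 (A : R -> O -> R) : Prop :=
  [/\ S2 A,
      forall w s t, 0 <= s -> s <= t -> t <= T -> A s w <= A t w &
      forall w, A 0 w = 0].

Record in_V (L : R -> O -> R) : Prop := {
  V_adapted : adapted L;
  V_range : forall w t, 0 <= t <= T -> 0 <= L t w <= 1;
  V_nonincreasing :
    forall w s t, 0 <= s -> s <= t -> t <= T -> L t w <= L s w;
  V_cadlag_right : forall w t, 0 <= t < T -> L s w @[s --> t^'+] --> L t w;
  V_cadlag_left : forall w t, 0 < t <= T -> cvg (L s w @[s --> t^'-]);
  V_end : forall w, L T w = 0 }.

Definition in_Vt (t : R) (L : R -> O -> R) : Prop :=
  in_V L /\ {ae P, forall w, left_limit (fun s => L s w) t = 1}.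

Variables (m : nat) (W : R -> O -> 'rV[R]_m).

(* Simple integrands: eta i on ]tau i, tau (i + 1)], i < N. *)
Record simple_integrand (N : nat) (tau : nat -> R) (eta : nat -> O -> 'rV[R]_m)
    : Prop := {
  si_start : tau 0%N = 0;
  si_end : tau N = T;
  si_mono : forall i, (i < N)%N -> tau i <= tau i.+1;
  si_measurable : forall i, (i < N)%N ->
    measurable_fun setT (eta i : g_sigma_algebraType (G (tau i)) -> 'rV[R]_m);
  si_bounded : exists C : R, forall i w, (i < N)%N -> enorm (eta i w) <= C }.

Definition simple_process (N : nat) (tau : nat -> R) (eta : nat -> O -> 'rV[R]_m)
    (s : R) (w : O) : 'rV[R]_m :=
  \sum_(i < N) (if tau i < s <= tau i.+1 then eta i w else 0).

Definition simple_integral (N : nat) (tau : nat -> R) (eta : nat -> O -> 'rV[R]_m)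
    (t : R) (w : O) : R :=
  \sum_(i < N)
    dotv (eta i w) (W (Num.min (tau i.+1) t) w - W (Num.min (tau i) t) w).

(* M is (a continuous version of) the Ito integral process
   of (Z_s, dW_s) over [0, t] : the L^2-limit of the integrals of simple
   integrands approximating Z in H^2. *)
Definition is_ito (Z : R -> O -> 'rV[R]_m) (M : R -> O -> R) : Prop :=
  [/\ H2 Z, adapted M,
      forall w, {within `[0, T], continuous (fun t => M t w)} &
      exists N : nat -> nat, exists tau : nat -> nat -> R,
      exists eta : nat -> nat -> O -> 'rV[R]_m,
      [/\ forall n, simple_integrand (N n) (tau n) (eta n),
          (fun n => \int[P]_w \int[lebesgue_measure]_(s in `[0%R, T])
             ((enorm (simple_process (N n) (tau n) (eta n) s w - Z s w)) ^+ 2)%:E)%E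
            @ \oo --> 0%E &
          forall t, 0 <= t <= T ->
          (fun n => \int[P]_w
             ((M t w - simple_integral (N n) (tau n) (eta n) t w) ^+ 2)%:E)%E
            @ \oo --> 0%E ]].

End Processes.

(* The paths of V and A2, extended to the line, do fall in the first case of
   [stieltjes]. *)
Lemma stieltjesE (R : realType) (F : R -> R)
    (H : {homo F : x y / x <= y} /\ right_continuous F) :
  stieltjes F = lebesgue_stieltjes_measure (cumulative_of H.1 H.2).
Proof.
rewrite /stieltjes; case: pselect => // H'.
by rewrite (Prop_irrelevance H' H).
Qed.

Section Path_measures.
Context {R : realType} {dO : measure_display} {O : measurableType dO}.
Variables (P : probability O R) (T : R) (G : R -> set (set O)).
Hypothesis T0 : 0 < T.

Lemma V_cumulative (L : R -> O -> R) (w : O) : in_V T G L ->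
  let F := fun s => - extL T (fun s => L s w) s in
  {homo F : x y / x <= y} /\ right_continuous F.
Proof.
move=> hL F; split.
- move=> x y xy; rewrite /F lerN2 /extL.
  case: (ltP y 0) => y0.
    by rewrite (le_lt_trans xy y0).
  case: (ltP x 0) => x0.
    case: (leP y T) => // yT.
    have y0T : 0 <= y <= T by rewrite y0 yT.
    by have /andP[] := V_range hL w y0T.
  case: (leP x T) => xT; last by rewrite (lt_geF (lt_le_trans xT xy)).
  case: (leP y T) => yT; first exact: (V_nonincreasing hL).
  have x0T : 0 <= x <= T by rewrite x0 xT.
  by have /andP[] := V_range hL w x0T.
- move=> x; apply: cvgN.
  rewrite /extL; case: (ltP x 0) => x0.
    apply: cvg_near_cst; near=> y; case: ifPn => //.
    by rewrite -leNgt => y0; exfalso; move: y0; apply/negP; rewrite -ltNge; near: y;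
       exact: nbhs_right_lt.
  case: (leP x T) => xT; last first.
    apply: cvg_near_cst; near=> y.
    have xy : x < y by near: y; exact: nbhs_right_gt.
    rewrite ltNge (le_trans x0 (ltW xy))/= leNgt (lt_trans xT xy)//.
  move: xT; rewrite le_eqVlt => /predU1P[->|xT].
    rewrite (V_end hL); apply: cvg_near_cst; near=> y.
    have xy : T < y by near: y; exact: nbhs_right_gt.
    by rewrite ltNge (ltW (lt_trans T0 xy))/= leNgt xy.
  have := V_cadlag_right hL (w := w) (t := x); rewrite x0 xT => /(_ isT).
  apply: cvg_trans; apply: near_eq_cvg; near=> y.
  have xy : x < y by near: y; exact: nbhs_right_gt.
  have yT : y < T by near: y; exact: nbhs_right_lt.
  by rewrite ltNge (le_trans x0 (ltW xy))/= (ltW yT).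
Unshelve. all: by end_near. Qed.

Lemma A_cumulative (A : R -> O -> R) (w : O) : A2 P T G A ->
  let F := fun s => A (Num.max 0 (Num.min s T)) w in
  {homo F : x y / x <= y} /\ right_continuous F.
Proof.
move=> [[_ cA _] ndA _] F; split.
- move=> x y xy; apply: ndA.
  + by rewrite le_max lexx.
  + rewrite ge_max; apply/andP; split; first by rewrite le_max lexx.
    by rewrite le_max; apply/orP; right; rewrite le_min !ge_min xy lexx orbT.
  + by rewrite ge_max (ltW T0) ge_min lexx orbT.
- apply: right_continuousW => x.
  have cl : forall y, `[0, T]%classic (Num.max 0 (Num.min y T)).
    move=> y; rewrite /= in_itv/= le_max lexx/= ge_max (ltW T0)/=.
    by rewrite ge_min lexx orbT.
  have /subspace_continuousP/(_ _ (cl x)) := cA w.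
  move=> h.
  have cc : (fun y : R => Num.max 0 (Num.min y T)) @ x --> Num.max 0 (Num.min x T).
    have c1 : (fun y : R => Num.min y T) @ x --> Num.min x T.
      under eq_fun do rewrite minr_absE.
      rewrite minr_absE; apply: cvgMl; apply: cvgB.
        by apply: cvgD; [exact: cvg_id|exact: cvg_cst].
      by apply: cvg_norm; apply: cvgB; [exact: cvg_id|exact: cvg_cst].
    under eq_fun do rewrite maxr_absE.
    rewrite maxr_absE; apply: cvgMl; apply: cvgD.
      by apply: cvgD; [exact: cvg_cst|exact: c1].
    by apply: cvg_norm; apply: cvgB; [exact: cvg_cst|exact: c1].
  have cw : (fun y : R => Num.max 0 (Num.min y T)) @ x -->
      within `[0, T] (nbhs (Num.max 0 (Num.min x T))).
    by move=> U hU; apply: (@filterS R (nbhs x) _ _ _ _ (cc _ hU)) => y h'; exact: h' (cl y).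
  exact: cvg_comp cw h.
Qed.
End Path_measures.

Record coefficients (R : realType) (d k m : nat) := Coefficients {
  co_b : R -> 'rV[R]_d -> 'rV[R]_k -> 'rV[R]_d;
  co_bbar : R -> 'rV[R]_d -> 'rV[R]_k;
  co_sigma : R -> 'rV[R]_d -> 'rV[R]_k -> 'M[R]_(d, m);
  co_sigmabar : R -> 'rV[R]_d -> 'rV[R]_k;
  co_f : R -> 'rV[R]_d -> 'rV[R]_k -> R;
  co_fbar : R -> 'rV[R]_d -> 'rV[R]_k;
  co_h : R -> 'rV[R]_d -> R -> R;
  co_phi : R -> R }.

Section Data.
Context {R : realType} {d k m : nat}.
Variables (T : R) (D : coefficients R d k m).

(* Coefficients are only relevant for times in [0, T] ([-T, T] for phi). *)
Record measurable_data : Prop := {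
  b_measurable :
    measurable_fun [set p : R * 'rV[R]_d * 'rV[R]_k | 0 <= p.1.1 <= T]
      (fun p => co_b D p.1.1 p.1.2 p.2);
  bbar_measurable :
    measurable_fun [set p : R * 'rV[R]_d | 0 <= p.1 <= T]
      (fun p => co_bbar D p.1 p.2);
  sigma_measurable :
    measurable_fun [set p : R * 'rV[R]_d * 'rV[R]_k | 0 <= p.1.1 <= T]
      (fun p => co_sigma D p.1.1 p.1.2 p.2);
  sigmabar_measurable :
    measurable_fun [set p : R * 'rV[R]_d | 0 <= p.1 <= T]
      (fun p => co_sigmabar D p.1 p.2);
  f_measurable :
    measurable_fun [set p : R * 'rV[R]_d * 'rV[R]_k | 0 <= p.1.1 <= T]
      (fun p => co_f D p.1.1 p.1.2 p.2);
  fbar_measurable :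
    measurable_fun [set p : R * 'rV[R]_d | 0 <= p.1 <= T]
      (fun p => co_fbar D p.1 p.2);
  h_measurable :
    measurable_fun [set p : R * 'rV[R]_d * R | 0 <= p.1.1 <= T]
      (fun p => co_h D p.1.1 p.1.2 p.2);
  phi_measurable : measurable_fun `[- T, T] (co_phi D) }.

Definition forward_lipschitz : Prop :=
  exists2 K : R, 0 <= K & forall t, 0 <= t <= T ->
  [/\ forall x x' y y',
        enorm (co_b D t x y - co_b D t x' y')
        + enorm (co_sigma D t x y - co_sigma D t x' y')
        <= K * (enorm (x - x') + enorm (y - y')),
      forall x x',
        enorm (co_bbar D t x - co_bbar D t x')
        + enorm (co_sigmabar D t x - co_sigmabar D t x')
        <= K * enorm (x - x') &
      enorm (co_b D t 0 0) + enorm (co_sigma D t 0 0)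
        + enorm (co_bbar D t 0) + enorm (co_sigmabar D t 0) <= K].

(* phi is C^1 on the closed interval [-T, T] (one-sided at the endpoints). *)
Definition C1_on (a b : R) (phi : R -> R) : Prop :=
  exists2 dphi : R -> R, {within `[a, b], continuous dphi} &
  forall x, a <= x <= b ->
    (phi y - phi x) / (y - x)
      @[y --> within [set y | a <= y <= b /\ y != x] (nbhs x)] --> dphi x.

Definition backward_regular (q : R) : Prop :=
  (exists K r : R, [/\ 0 <= K, 1 <= r, r < q / 2 & forall t, 0 <= t <= T ->
    [/\ forall x y y',
          `|co_f D t x y' - co_f D t x y| <= K * enorm (y' - y),
        forall x,
          `|co_f D t x 0| + `|co_h D t x 0| + enorm (co_fbar D t x)
          <= K * (1 + enorm x `^ r) &
        forall x v v', `|co_h D t x v - co_h D t x v'| <= K * `|v - v'|]])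
  /\ {within [set p : R * 'rV[R]_d * R | 0 <= p.1.1 <= T],
        continuous (fun p => co_h D p.1.1 p.1.2 p.2)}
  /\ C1_on (- T) T (co_phi D).

End Data.

Section Equations.
Context {R : realType} {dO : measure_display} {O : measurableType dO}.
Context {d k m : nat}.
Variables (P : probability O R) (T : R) (W : R -> O -> 'rV[R]_m).
Variables (X0 : O -> 'rV[R]_d) (D : coefficients R d k m).
Variables (L : R -> O -> R) (X : R -> O -> 'rV[R]_d).

Let G := filtration P W X0.

(* E[g(s, X_s) L_s] *)
Definition interaction (g : R -> 'rV[R]_d -> 'rV[R]_k) (s : R) : 'rV[R]_k :=
  \row_j \int[P]_w (g s (X s w) 0 j * L s w).

Definition b_path (w : O) (s : R) : 'rV[R]_d :=
  co_b D s (X s w) (interaction (co_bbar D) s).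
Definition sigma_path (w : O) (s : R) : 'M[R]_(d, m) :=
  co_sigma D s (X s w) (interaction (co_sigmabar D) s).
Definition f_path (w : O) (s : R) : R :=
  co_f D s (X s w) (interaction (co_fbar D) s).

Definition forward_solution : Prop :=
  S2v P T G X /\
  exists2 M : R -> O -> 'rV[R]_d,
    forall i, is_ito P T G W (fun s w => row i (sigma_path w s))
                (fun t w => M t w 0 i) &
    {ae P, forall w,
      (forall i, lebesgue_measure.-integrable `[0, T]
                   (fun s => (b_path w s 0 i)%:E)) /\
      (forall t, 0 <= t <= T ->
        X t w = X0 w
          + \row_i \int[lebesgue_measure]_(s in `[0, t]) b_path w s 0 i
          + M t w)}.

Definition xi (t : R) (w : O) : R :=
  co_h D t (X t w)
    (\int[P]_w' intL T 0 (fun s => co_phi D (t - s)) (fun s => L s w')).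

Record rbsde_solution (Y : R -> O -> R) (Z : R -> O -> 'rV[R]_m)
    (A : R -> O -> R) : Prop := {
  rb_Y : S2 P T G Y;
  rb_Z : H2 P T G Z;
  rb_A : A2 P T G A;
  rb_eq : exists2 M : R -> O -> R, is_ito P T G W Z M &
    {ae P, forall w,
      lebesgue_measure.-integrable `[0, T] (fun s => (f_path w s)%:E) /\
      (forall t, 0 <= t <= T ->
        Y t w = xi T w + \int[lebesgue_measure]_(s in `[t, T]) f_path w s
          + (A T w - A t w) - (M T w - M t w))};
  rb_obstacle : {ae P, forall w, forall t, 0 <= t <= T -> xi t w <= Y t w};
  rb_skorokhod : {ae P, forall w,
    intA T (fun s => Y s w - xi s w) (fun s => A s w) = 0} }.

(* The random variable whose conditional expectation given F_t is
   Lambda_t(L, L'). *)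
Definition payoff (t : R) (L' : R -> O -> R) (w : O) : R :=
  \int[lebesgue_measure]_(s in `[t, T]) (f_path w s * L' s w)
  - intL T t (fun s => xi s w) (fun s => L' s w).

(* V = Lambda_t(L, L') almost surely. *)
Definition is_Lambda (t : R) (L' : R -> O -> R) (V : O -> R) : Prop :=
  is_cond_exp P (G t) (payoff t L') V.

End Equations.

(* Main.v *)
(** Let M be the stochastic integral of Z.  For almost every path, inserting
    the reflected equation into the integral of Y against d Lhat and exchanging
    the order of integration in the drift term (the measure - d Lhat of ]r, T]
    is Lhat_r, and - d Lhat has total mass 1 on [t, T]) gives
      payoff = Y_t + int (Y - xi) d Lhat + int A^t d Lhat - int (M - M_t) d Lhat.
    Summation by parts exhibits the last integral as a limit of martingale
    transforms of M by - Lhat, bounded in L^2 because |Lhat| <= 1, so its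
    conditional expectation given F_t is 0.  The two middle terms are
    nonpositive; hence the conditional expectation of the payoff is Y_t if and
    only if both vanish almost surely. *)

Require Import Defs.
From mathcomp Require Import measurable_realfun ring lra.
Set Implicit Arguments.
Unset Strict Implicit.
Unset Printing Implicit Defensive.
Import Order.TTheory GRing.Theory Num.Theory.
Import numFieldNormedType.Exports.

Local Open Scope classical_set_scope.
Local Open Scope ring_scope.

(** Two obstacles shape the proof: the stochastic integral is given only as an L^2-limit of simple
    integrals, and [payoff] comes with neither measurability nor integrability. Zero conditional
    expectation is therefore handled as vanishing integrals over the sets of a sigma-algebra
    ([centered]), starting from Brownian increments, where it results from their Gaussian law and
    their independence of X0, the past and the null sets. All integrands against - d Lhat are
    continuous paths or primitives, so the former integrals are limits of sums over uniform grids.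
    For the martingale transforms no dominating variable is at hand; orthogonality of the increments
    bounds their second moments by that of M_T - M_t, and pointwise convergence with bounded second
    moments lets the integrals pass to the limit. The two nonpositive terms are treated through
    their sum, which is a.s. payoff - Y_t + int (M - M_t) d Lhat and inherits integrability from it.
    Conversely, completeness of P carries integrability back to the payoff. *)

Section RealIntegrable.
Context {d} {T : measurableType d} {R : realType}.
Variables (mu : {measure set T -> \bar R}) (D : set T).
Hypothesis mD : measurable D.
Implicit Types f g : T -> R.

Lemma integrable_subr f g : mu.-integrable D (EFin \o f) ->
  mu.-integrable D (EFin \o g) -> mu.-integrable D (EFin \o (fun x => f x - g x)).
Proof.
move=> fi gi; apply: eq_integrable (integrableB mD fi gi) => // x _ /=.
Qed.

Lemma integrable_addr f g : mu.-integrable D (EFin \o f) ->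
  mu.-integrable D (EFin \o g) -> mu.-integrable D (EFin \o (fun x => f x + g x)).
Proof.
move=> fi gi; apply: eq_integrable (integrableD mD fi gi) => // x _ /=.
Qed.

Lemma integrable_mulcr (c : R) f : mu.-integrable D (EFin \o f) ->
  mu.-integrable D (EFin \o (fun x => c * f x)).
Proof.
by move=> fi; apply: eq_integrable (integrableZl mD c fi) => // x _ /=.
Qed.

Lemma integrable_oppr f : mu.-integrable D (EFin \o f) ->
  mu.-integrable D (EFin \o (fun x => - f x)).
Proof.
by move=> fi; apply: eq_integrable (integrableN fi) => // x _ /=.
Qed.

End RealIntegrable.

(** * Lebesgue-Stieltjes integrals of continuous functions *)

Section StieltjesMeasure.
Context {R : realType}.
Implicit Types (a b c s : R) (g : R -> R).

(** Heine's theorem in the subspace topology. Compactness enters through near coverings: a radius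
    that serves one point serves all points near it, as do all smaller radii, so one radius serves
    the whole segment. *)
Lemma uniform_continuity_segment a b g : {within `[a, b], continuous g} ->
  forall e, 0 < e -> exists2 d, 0 < d &
    forall x y, a <= x <= b -> a <= y <= b -> `|x - y| <= d ->
      `|g x - g y| <= e.
Proof.
move=> /subspace_continuousP cg e e0.
have /compact_near_coveringP cov := @segment_compact R a b.
have := cov R (0^'+) (fun d x => a <= x <= b ->
  forall y, a <= y <= b -> `|x - y| <= d -> `|g x - g y| <= e) _.
case.
- move=> x xab; have /cvgrPdist_lt/(_ _ (divr_gt0 e0 (ltr0Sn _ 1))) := cg _ xab.
  rewrite nearE /within /= => /nbhs_ballP[r /= r0 hr].
  have r20 : 0 < r / 2 by rewrite divr_gt0.
  exists (ball x (r / 2), [set d | d < r / 2]) => /=.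
    split; first exact: nbhsx_ballx.
    exact: nbhs_right_lt.
  move=> [x' d] /= [xx' dr] x'ab y yab x'y.
  have gx' : `|g x - g x'| < e / 2.
    apply: hr; last by rewrite /= in_itv.
    by apply: le_ball xx'; rewrite ler_pdivrMr// ler_pMr// ler1n.
  have gy : `|g x - g y| < e / 2.
    apply: hr; last by rewrite /= in_itv.
    rewrite /ball /= (_ : x - y = (x - x') + (x' - y)); last by ring.
    rewrite (le_lt_trans (ler_normD _ _))// (splitr r) ltrD//.
    exact: le_lt_trans dr.
  rewrite (_ : g x' - g y = (g x - g y) - (g x - g x')); last by ring.
  rewrite (le_trans (ler_normB _ _))// (splitr e).
  by rewrite lerD// ltW.
- move=> d0 /= d00 hd.
  exists (d0 / 2); first by rewrite divr_gt0.
  move=> x y xab yab xy; apply: (hd (d0 / 2)) => //=.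
  - rewrite /ball/= sub0r normrN gtr0_norm ?divr_gt0//.
    by rewrite ltr_pdivrMr// ltr_pMr// ltr1n.
  - by rewrite divr_gt0.
Qed.

Variable F : R -> R.
Hypothesis HF : {homo F : x y / x <= y} /\ right_continuous F.

Lemma stieltjes_oc a b : a <= b -> stieltjes F `]a, b]%classic = (F b - F a)%:E.
Proof.
move=> ab; rewrite (stieltjesE HF) /= /lebesgue_stieltjes_measure /measure_extension.
rewrite measurable_mu_extE/=; last exact: is_ocitv.
by rewrite wlength_itv_bnd.
Qed.

Lemma itvcc_bigcap a b :
  `[a, b]%classic = \bigcap_n `]a - n.+1%:R^-1, b]%classic :> set R.
Proof.
apply/seteqP; split => [x|x h] /=.
  rewrite in_itv/= => /andP[ax xb] n _ /=; rewrite in_itv/= xb andbT.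
  by rewrite ltrBlDr (le_lt_trans ax)// ltrDl invr_gt0.
have := h 0%N I; rewrite /= !in_itv/= => /andP[_ ->]; rewrite andbT.
rewrite leNgt; apply/negP => xa.
have [n hn] := @ltr_add_invr R x a xa.
have := h n I; rewrite /= in_itv/= => /andP[]; rewrite ltNge => /negP[].
by rewrite lerBrDr ltW.
Qed.

(** A closed interval carries the jump at its left endpoint: [a, b] is the decreasing intersection
    of the intervals ]a - 1/(n+1), b], and continuity from above turns [F a] into the left limit. *)
Lemma stieltjes_cc a b c : a <= b -> F s @[s --> a^'-] --> c ->
  stieltjes F `[a, b]%classic = (F b - c)%:E.
Proof.
move=> ab cF.
have sinv : (fun n => a - n.+1%:R^-1) @ \oo --> a.
  rewrite -[X in _ --> X]subr0; apply: cvgB; first exact: cvg_cst.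
  exact: cvg_harmonic.
have cvg1 : (fun n => F (a - n.+1%:R^-1)) @ \oo --> c.
  have /cvg_at_leftP := cF; apply; split => // n.
  by rewrite ltrBlDr ltrDl invr_gt0.
have lt_b n : a - n.+1%:R^-1 <= b.
  by rewrite (le_trans _ ab)// lerBlDr lerDl invr_ge0.
have cvg2 : stieltjes F \o (fun n => `]a - n.+1%:R^-1, b]%classic) @ \oo -->
    (F b - c)%:E.
  rewrite (_ : _ \o _ = (fun n => (F b - F (a - n.+1%:R^-1))%:E)); last first.
    by apply/funext => n /=; rewrite stieltjes_oc.
  apply: cvg_EFin; first exact: nearW.
  by apply: cvgB => //; exact: cvg_cst.
have := @nonincreasing_cvg_mu _ _ R (stieltjes F)
  (fun n => `]a - n.+1%:R^-1, b]%classic).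
rewrite -itvcc_bigcap => /(_ _ _ _ _) h.
apply/esym; apply: (cvg_unique _ cvg2); first exact: ereal_hausdorff.
apply: h.
- by rewrite stieltjes_oc ?ltry//.
- by move=> n; exact: measurable_itv.
- exact: measurable_itv.
- move=> n m nm; apply/subsetPset => x /=; rewrite !in_itv/= => /andP[+ ->].
  rewrite andbT; apply: le_lt_trans; rewrite lerD2l lerN2.
  by rewrite lef_pV2 ?posrE// ler_nat.
Qed.

Lemma stieltjes_cc_lty a b : (stieltjes F `[a, b]%classic < +oo)%E.
Proof.
have [ab|ba] := leP a b; last by rewrite set_itv_ge -?ltNge// measure0 ltry.
apply: (@le_lt_trans _ _ (stieltjes F `]a - 1, b]%classic)).
  apply: le_measure; rewrite ?inE; [exact: measurable_itv..|].
  move=> x /=; rewrite !in_itv/= => /andP[ax ->]; rewrite andbT.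
  by rewrite (lt_le_trans _ ax)// ltrBlDr ltrDl.
by rewrite stieltjes_oc ?ltry// (le_trans _ ab)// lerBlDr lerDl.
Qed.

Lemma within_continuous_measurable a b g : {within `[a, b], continuous g} ->
  measurable_fun `[a, b] g.
Proof.
by move=> cg; apply: subspace_continuous_measurable_fun => //; exact: measurable_itv.
Qed.

Lemma stieltjes_integrable a b g : {within `[a, b], continuous g} ->
  (stieltjes F).-integrable `[a, b] (EFin \o g).
Proof.
move=> cg; apply: measurable_bounded_integrable.
- exact: measurable_itv.
- exact: stieltjes_cc_lty.
- exact: within_continuous_measurable.
- have := compact_bounded (continuous_compact cg (@segment_compact R a b)).
  move=> [M [Mr hM]]; exists M; split => // x Mx y yab; apply: hM => //.
Qed.

End StieltjesMeasure.

(** * Uniform grids and Riemann-Stieltjes sums *)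

Definition grid {R : realType} (a b : R) (n i : nat) : R :=
  a + (b - a) * (i%:R / n%:R).

Section Grid.
Context {R : realType}.
Variables (a b : R) (n : nat).
Hypothesis ab : a <= b.

Lemma grid0 : grid a b n 0 = a.
Proof. by rewrite /grid mul0r mulr0 addr0. Qed.

Lemma gridnn : (0 < n)%N -> grid a b n n = b.
Proof. by move=> n0; rewrite /grid divff ?pnatr_eq0 -?lt0n// mulr1 subrKC. Qed.

Lemma grid_le i j : (i <= j)%N -> grid a b n i <= grid a b n j.
Proof.
move=> ij; rewrite lerD2l ler_wpM2l ?subr_ge0// ler_wpM2r ?invr_ge0 ?ler0n//.
by rewrite ler_nat.
Qed.

Lemma grid_itv i : (0 < n)%N -> (i <= n)%N -> a <= grid a b n i <= b.
Proof.
move=> n0 iN; have := grid_le (leq0n i); have := grid_le iN.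
by rewrite grid0 gridnn// => -> ->.
Qed.

Lemma grid_step i : grid a b n i.+1 - grid a b n i = (b - a) / n%:R.
Proof. by rewrite /grid -natr1 mulrDl; ring. Qed.

End Grid.

Lemma cvg_mesh {R : realType} (a : R) d : 0 < d -> \forall n \near \oo, a / n.+1%:R <= d.
Proof.
move=> d0; have : (fun n => a * n.+1%:R^-1) @ \oo --> a * 0.
  by apply: cvgM; [exact: cvg_cst|exact: cvg_harmonic].
rewrite mulr0 => /cvgrPdist_le/(_ _ d0); apply: filterS => n.
by rewrite sub0r normrN; apply: le_trans; exact: ler_norm.
Qed.

Section RiemannStieltjes.
Context {R : realType}.
Variable F : R -> R.
Hypothesis HF : {homo F : x y / x <= y} /\ right_continuous F.
Local Notation nu := (stieltjes F).

(** The integrand is evaluated at the right endpoint of each cell. Summation by parts then leaves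
    the integrator at the left endpoint, which is what turns these sums into martingale
    transforms. *)
Definition riemann_sum a b (g : R -> R) n : R := \sum_(i < n)
  g (grid a b n i.+1) * (F (grid a b n i.+1) - F (grid a b n i)).

Let integrable_oc (g : R -> R) (a b s s' : R) : {within `[a, b], continuous g} ->
  a <= s -> s' <= b -> nu.-integrable `]s, s'] (EFin \o g).
Proof.
move=> cg sa sb; apply: (@integrableS _ _ _ nu `[a, b]%classic).
- exact: measurable_itv.
- exact: measurable_itv.
  move=> x/=; rewrite !in_itv/= => /andP[sx xs'].
  by rewrite (le_trans sa (ltW sx)) (le_trans xs').
exact: stieltjes_integrable.
Qed.

Let step (g : R -> R) (a b s s' e : R) : {within `[a, b], continuous g} ->
  a <= s -> s <= s' -> s' <= b ->
  (forall x, s < x <= s' -> `|g x - g s'| <= e) ->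
  `|\int[nu]_(x in `]s, s']) g x - g s' * (F s' - F s)| <= e * (F s' - F s).
Proof.
move=> cg sa ss' sb ge.
have mI : measurable (`]s, s']%classic : set (measurableTypeR R)).
  exact: measurable_itv.
have ic (c : R) : nu.-integrable `]s, s'] (EFin \o cst c).
  by apply: (@integrable_oc (cst c) a b) => //; move=> x; exact: cvg_cst.
have ig := @integrable_oc g a b _ _ cg sa sb.
have Ec (c : R) : \int[nu]_(x in `]s, s']) c = c * (F s' - F s).
  by rewrite Rintegral_cst//= stieltjes_oc.
have iB : nu.-integrable `]s, s'] (EFin \o (fun x => g x - g s')).
  by have := integrable_subr mI ig (ic (g s')).
rewrite -!Ec -(RintegralB mI ig (ic _)).
have := le_normr_Rintegral mI iB => /le_trans; apply.
apply: le_Rintegral => //; first exact: integrable_norm iB.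
  exact: ic.
Qed.

Lemma riemann_stieltjes (a b : R) (g : R -> R) : a <= b ->
  {within `[a, b], continuous g} ->
  (fun n => riemann_sum a b g n.+1) @ \oo --> \int[nu]_(s in `]a, b]) g s.
Proof.
move=> ab cg; apply/cvgrPdist_le => e e0.
have Fab : 0 <= F b - F a by rewrite subr_ge0; apply: HF.1.
(* The errors of the cells add up to this number times [F b - F a]; the added 1 keeps the
   denominator positive when [F b = F a]. *)
have e'0 : 0 < e / (F b - F a + 1) by rewrite divr_gt0// ltr_wpDl.
have [d d0 hd] := uniform_continuity_segment cg e'0.
near=> n.
have mesh : (b - a) / n.+1%:R <= d by near: n; exact: cvg_mesh.
set s := grid a b n.+1.
(* The error on an initial stretch of the grid is bounded by the mass of that stretch, so that the
   bounds of successive cells telescope. *)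
suff main j : (j <= n.+1)%N ->
    `|\int[nu]_(x in `]a, s j]) g x
      - \sum_(i < j) g (s i.+1) * (F (s i.+1) - F (s i))|
    <= e / (F b - F a + 1) * (F (s j) - F a).
  have := main n.+1 (leqnn _).
  rewrite /s gridnn// => /le_trans; apply.
  rewrite -mulrA mulrC -[leRHS]mul1r ler_wpM2r ?(ltW e0)//.
  by rewrite mulrC ler_pdivrMr ?ltr_wpDl// mul1r lerDl.
elim: j => [_|j IH jn].
  by rewrite /s grid0 big_ord0 set_itv_ge ?bnd_simp ?ltxx// Rintegral_set0 !subrr normr0 mulr0.
have sj := grid_itv ab (ltn0Sn n) (ltnW jn).
have sj1 := grid_itv ab (ltn0Sn n) jn.
have sjj : s j <= s j.+1 by exact: grid_le.
rewrite -/s in sj sj1; case/andP: (sj) => asj sjb; case/andP: (sj1) => asj1 sj1b.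
rewrite big_ord_recr/= (@itv_bndbnd_setU _ _ _ (BRight (s j))) ?bnd_simp//.
rewrite Rintegral_setU//=; last 2 first.
  rewrite -itv_bndbnd_setU ?bnd_simp//.
  exact: (integrable_oc cg).
  apply/disj_setPS => x []/=; rewrite !in_itv/= => /andP[_ xs] /andP[].
  by rewrite ltNge xs.
set I1 := Rintegral _ _ _; set I2 := Rintegral _ _ _; set S := \sum_(i < j) _.
rewrite (_ : _ - _ = (I1 - S) + (I2 - g (s j.+1) * (F (s j.+1) - F (s j)))); last by ring.
rewrite (le_trans (ler_normD _ _))//.
rewrite (_ : F (s j.+1) - F a = (F (s j) - F a) + (F (s j.+1) - F (s j))); last by ring.
rewrite [leRHS]mulrDr; apply: lerD; first exact: IH (ltnW jn).
apply: (step cg) => // x /andP[sx xs]; apply: hd => //.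
  by rewrite (le_trans asj (ltW sx)) (le_trans xs).
rewrite distrC ger0_norm ?subr_ge0// (le_trans _ mesh)//.
by rewrite -(grid_step a b n.+1 j) lerB// ltW.
Unshelve. all: by end_near. Qed.

(** Riemann sums see only half-open cells, so the atom at the left endpoint is split off. *)
Lemma stieltjes_cc_split (a b : R) (g : R -> R) : a <= b ->
  {within `[a, b], continuous g} ->
  \int[nu]_(s in `[a, b]) g s =
  g a * fine (nu [set a]) + \int[nu]_(s in `]a, b]) g s.
Proof.
move=> ab cg; rewrite -(@setU1itv _ _ _ a false) ?bnd_simp// Rintegral_setU//=; last 2 first.
  by rewrite setU1itv ?bnd_simp//; exact: stieltjes_integrable.
  apply/disj_setPS => x []/= ->; rewrite in_itv/= ltxx//.
congr (_ + _).
rewrite -[in RHS](Rintegral_cst nu (measurable_set1 a)).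
by apply: eq_Rintegral => x; rewrite inE/= => ->.
Qed.

End RiemannStieltjes.

(** * Integrals against the paths of processes in V *)

Section PathIntegral.
Context {R : realType} {dO : measure_display} {O : measurableType dO}.
Variables (T : R) (G : R -> set (set O)) (L : R -> O -> R) (w : O).
Hypotheses (T0 : 0 < T) (hL : in_V T G L).

Local Notation l := (fun s => L s w).
Local Notation F := (fun s => - extL T l s).
Local Notation nu := (stieltjes F).

Let HF : {homo F : x y / x <= y} /\ right_continuous F := V_cumulative T0 w hL.

Lemma extL_in s : 0 <= s <= T -> extL T l s = l s.
Proof. by move=> /andP[s0 sT]; rewrite /extL ltNge s0/= sT. Qed.

(** For t > 0 this is the left limit of the path itself; at t = 0 the value 1 of the extension on
    the negative half-line realises the convention L_{0-} = 1. *)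
Lemma extL_left_limit t : 0 <= t <= T -> left_limit l t = 1 ->
  F s @[s --> t^'-] --> (-1 : R).
Proof.
move=> /andP[t0 tT]; rewrite /left_limit; case: ifPn => [tgt0 lim1|].
  have tT' : 0 < t <= T by rewrite tgt0.
  have lt1 : L s w @[s --> t^'-] --> (1 : R).
    by rewrite -lim1; exact: V_cadlag_left hL w t tT'.
  apply: cvgN; apply: cvg_trans lt1; apply: near_eq_cvg; near=> s.
  have s0 : 0 < s by near: s; exact: nbhs_left_gt.
  have st : s < t by near: s; exact: nbhs_left_lt.
  by rewrite extL_in// (ltW s0) (le_trans (ltW st)).
rewrite -leNgt => t0' _; have -> : t = 0 by apply/eqP; rewrite eq_le t0 t0'.
apply: cvgN; apply: cvg_near_cst; near=> s.
have s0 : s < 0 by near: s; exact: nbhs_left_lt.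
by rewrite /extL s0.
Unshelve. all: by end_near. Qed.

(** The integrator rises from -1 at t- to 0 at T, since the path ends at 0. This normalisation is
    why Y_t leaves the integral with coefficient 1. *)
Lemma V_mass t : 0 <= t <= T -> left_limit l t = 1 ->
  nu `[t, T]%classic = 1%E.
Proof.
move=> tT /(extL_left_limit tT) h; case/andP: (tT) => t0 tT'.
rewrite (stieltjes_cc HF tT' h) extL_in ?lexx ?(ltW T0)//.
by rewrite (V_end hL) oppr0 add0r opprK.
Qed.

Lemma V_atom0 : nu [set 0] = (1 - l 0)%:E.
Proof.
have := @stieltjes_cc R F HF 0 0 (-1) (lexx _).
rewrite set_itv1 extL_in ?lexx ?(ltW T0)// => ->; first by rewrite opprK addrC.
by apply: extL_left_limit; rewrite ?lexx ?(ltW T0)// /left_limit ltxx.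
Qed.

(** Only finitely many values of L enter each approximation, which yields measurability of the
    integral in the sample point. *)
Lemma cvg_intL0 (g : R -> R) : {within `[0, T], continuous g} ->
  (fun n => - (g 0 * (1 - l 0) + \sum_(i < n.+1)
     g (grid 0 T n.+1 i.+1) * (l (grid 0 T n.+1 i) - l (grid 0 T n.+1 i.+1))))
  @ \oo --> intL T 0 g l.
Proof.
move=> cg; rewrite /intL; apply: cvgN.
rewrite (stieltjes_cc_split HF (ltW T0))// V_atom0/=.
apply: cvgD; first exact: cvg_cst.
apply: cvg_trans (riemann_stieltjes HF (ltW T0) cg).
apply: near_eq_cvg; apply: nearW => n; apply: eq_bigr => i _.
rewrite !extL_in ?grid_itv ?(ltW T0)//.
  by rewrite opprK [in RHS]addrC.
by rewrite ltnW.
Qed.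

(** Summation by parts. The condition [g t = 0] removes both the atom at t and the lower boundary
    term, and [l T = 0] removes the upper one. The factor [l] sits at the left endpoint, hence is
    known before the increment of [g]. *)
Lemma cvg_intL_martingale (t : R) (g : R -> R) : 0 <= t <= T ->
  {within `[t, T], continuous g} -> g t = 0 ->
  (fun n => - (\sum_(i < n.+1)
     l (grid t T n.+1 i) * (g (grid t T n.+1 i.+1) - g (grid t T n.+1 i))))
  @ \oo --> intL T t g l.
Proof.
move=> /andP[t0 tT] cg gt0; rewrite /intL; apply: cvgN.
rewrite (stieltjes_cc_split HF tT)// gt0 mul0r add0r.
apply: cvg_trans (riemann_stieltjes HF tT cg).
apply: near_eq_cvg; apply: nearW => n; rewrite /riemann_sum.
set s := grid t T n.+1.
have sI i : (i <= n.+1)%N -> 0 <= s i <= T.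
  by move=> /(grid_itv tT (ltn0Sn n))/andP[ts ->]; rewrite (le_trans t0 ts).
under eq_bigr => i _ do rewrite !extL_in ?sI ?(ltnW (ltn_ord i))// opprK.
apply/eqP; rewrite -subr_eq0 -sumrB; apply/eqP.
rewrite (eq_bigr (fun i : 'I_n.+1 => l (s i) * g (s i) - l (s i.+1) * g (s i.+1)));
  last by move=> i _; ring.
rewrite -(big_mkord xpredT (fun i => l (s i) * g (s i) - l (s i.+1) * g (s i.+1))).
rewrite (@telescope_sumr_eq _ 0 n.+1 (fun i => - (l (s i) * g (s i))))//; last first.
  by move=> i _; ring.
by rewrite /s gridnn// grid0 (V_end hL) gt0 mulr0 mul0r subrr.
Qed.

End PathIntegral.

(** * Exchange of a Lebesgue and a Stieltjes integral *)

Section StieltjesFubini.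
Context {R : realType}.
Variable F : R -> R.
Hypothesis HF : {homo F : x y / x <= y} /\ right_continuous F.
Local Notation nu := (stieltjes F).
Local Notation leb := (@lebesgue_measure R).

Lemma stieltjes_fubini (a b : R) (f : R -> R) : a <= b ->
  leb.-integrable `[a, b] (EFin \o f) ->
  \int[nu]_(s in `[a, b]) (\int[leb]_(r in `[a, s]) f r) =
  \int[leb]_(r in `[a, b]) (f r * (F b - F r)).
Proof.
move=> ab fi.
(* [stieltjes] is typed as a mere measure; [m1] is the same measure with the sigma-finiteness
   required by Fubini's theorem. *)
pose m1 : {sigma_finite_measure set (measurableTypeR R) -> \bar R} :=
  lebesgue_stieltjes_measure (cumulative_of HF.1 HF.2).
have nuE : nu = m1 :> {measure set (measurableTypeR R) -> \bar R}.
  exact: stieltjesE.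
have mab : measurable (`[a, b]%classic : set (measurableTypeR R)).
  exact: measurable_itv.
pose f' : measurableTypeR R -> R := f \_ `[a, b].
have f'i : leb.-integrable setT (EFin \o f').
  by rewrite /f' -restrict_EFin; exact: (integrable_mkcond _ mab).1.
have mf' : measurable_fun setT f' by apply/measurable_EFinP; exact: measurable_int f'i.
(* The triangle is strict so that its section at r is ]r, b], of mass [F b - F r]. On the Lebesgue
   side the lost endpoint s has measure 0. *)
pose lt2 : set (measurableTypeR R * measurableTypeR R) := [set p | p.2 < p.1].
have mlt2 : measurable lt2.
  rewrite -[lt2]setTI; apply: (@measurable_fun_ltr _ _ R setT snd fst) => //.
pose h (p : measurableTypeR R * measurableTypeR R) : \bar R :=
  (f' p.2 * (\1_(`[a, b]%classic : set (measurableTypeR R)) p.1 * \1_lt2 p))%:E.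
have mh : measurable_fun setT h.
  apply/measurable_EFinP; apply: measurable_funM.
    exact: measurableT_comp.
  by apply: measurable_funM; [apply: measurableT_comp => //|exact: measurable_indic].
(* The section at s has L^1 norm at most that of [f'], and vanishes off [a, b], a set of finite
   Stieltjes mass. *)
have hi : (m1 \x leb)%E.-integrable setT h.
  apply: ((@integrable12ltyP _ _ _ _ R m1 leb h mh).2).
  pose C := (\int[leb]_r `|(f' r)%:E|)%E.
  have C0 : (0 <= C)%E by exact: integral_ge0.
  have Cfin : C \is a fin_num by rewrite ge0_fin_numE//; case/integrableP : f'i.
  apply: (@le_lt_trans _ _ (\int[m1]_s ((fine C * \1_(`[a, b]%classic : set (measurableTypeR R)) s)%:E))%E).
    apply: ge0_le_integral => //.
    - by move=> s _; exact: integral_ge0.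
    - have mah := measurableT_comp (@abse_measurable R setT) mh.
      by exact: (@measurable_fun_fubini_tonelli_F _ _ _ _ R leb (abse \o h) mah (fun=> abse_ge0 _)).
    - apply/measurable_EFinP; apply: measurable_funM => //.
    - move=> s _; rewrite EFinM fineK// muleC.
      have maf : measurable_fun setT (fun r : measurableTypeR R => `|(f' r)%:E|%E).
        exact: measurableT_comp (@abse_measurable R setT) (measurable_int _ f'i).
      rewrite -ge0_integralZl//.
      apply: ge0_le_integral => //.
      - exact: measurableT_comp (@abse_measurable R setT) (measurableT_comp mh (pair1_measurable s)).
      - by apply: emeasurable_funM.
      - move=> r _; rewrite /h/= -EFinM lee_fin !normrM mulrC ler_wpM2r//.
        rewrite !ger0_norm// ler_piMr//.
  rewrite -/C; under eq_integral do rewrite EFinM.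
  rewrite ge0_integralZl//; last 2 first.
    exact/measurable_EFinP/measurable_indic.
    by rewrite lee_fin fine_ge0.
  by rewrite integral_indic// setIT -nuE fineK// lte_mul_pinfty// stieltjes_cc_lty.
have := Fubini hi.
have E1 s : (\int[leb]_r h (s, r) =
   ((fun s => \int[leb]_(r in `[a, s]) f r) \_ `[a, b] s)%:E)%E.
  rewrite /patch; case: ifPn => [|sab]; last first.
    rewrite integral0_eq// => r _; rewrite /h/= indicE (negbTE sab) mul0r mulr0//.
  rewrite inE/= in_itv/= => /andP[as_ sb].
  have sI : (s \in (`[a, b]%classic : set R)) by rewrite inE/= in_itv/= as_ sb.
  have fs : leb.-integrable `[a, s] (EFin \o f).
    by apply: integrableS fi => //; apply: subset_itvl; rewrite bnd_simp.
  transitivity (\int[leb]_(r in `[a, s[) (f r)%:E)%E.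
    rewrite [RHS]integral_mkcond; apply: eq_integral => r _.
    rewrite /h/= indicE sI mul1r /f' !patchE indicE.
    have -> : (r \in (`[a, s[%classic : set R)) =
              (r \in (`[a, b]%classic : set R)) && ((s, r) \in lt2).
      apply/idP/andP; rewrite !inE/= !in_itv/=.
        by move=> /andP[-> rs]; rewrite (ltW (lt_le_trans rs sb)).
      by move=> [/andP[-> _] ->].
    by case: ifPn => _; case: ((s, r) \in lt2); rewrite ?mulr1 ?mulr0.
  rewrite integral_itv_bndo_bndc//; last first.
    by apply: measurable_funS (measurable_int _ fs) => //; exact: subset_itv_co_cc.
  by rewrite /Rintegral fineK//; exact: integrable_fin_num.
have E2 r : (\int[m1]_s h (s, r) =
   ((fun r => f r * (F b - F r)) \_ `[a, b] r)%:E)%E.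
  rewrite patchE; case: ifPn => [|rab]; last first.
    by rewrite integral0_eq// => s _; rewrite /h/= /f' patchE (negbTE rab) mul0r.
  move=> rI; move: (rI); rewrite inE/= in_itv/= => /andP[ar rb].
  rewrite EFinM -(stieltjes_oc HF rb) nuE -integral_cst//.
  rewrite [RHS]integral_mkcond; apply: eq_integral => s _.
  rewrite /h/= /f' !patchE rI !indicE.
  have -> : (s \in (`]r, b]%classic : set R)) =
            (s \in (`[a, b]%classic : set R)) && ((s, r) \in lt2).
    apply/idP/andP; rewrite !inE/= !in_itv/=.
      by move=> /andP[rs ->]; rewrite (le_trans ar (ltW rs)).
    by move=> [/andP[_ ->] ->].
  by case: (s \in _); case: ((s, r) \in lt2); rewrite ?mulr1 ?mulr0.
under eq_integral do rewrite E1.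
under [X in _ = X -> _]eq_integral do rewrite E2.
move=> /(congr1 fine).
by rewrite -/(Rintegral _ _ _) -/(Rintegral _ _ _) -!Rintegral_mkcond nuE.
Qed.

End StieltjesFubini.

(** * The pathwise decomposition of the payoff *)

Section PathIdentity.
Context {R : realType} {dO : measure_display} {O : measurableType dO}.
Variables (T : R) (G : R -> set (set O)) (L : R -> O -> R) (w : O).
Hypotheses (T0 : 0 < T) (hL : in_V T G L).

Local Notation l := (fun s => L s w).
Local Notation F := (fun s => - extL T l s).
Local Notation nu := (stieltjes F).
Local Notation leb := (@lebesgue_measure R).

Let HF : {homo F : x y / x <= y} /\ right_continuous F := V_cumulative T0 w hL.

Lemma intL_le0 t (g : R -> R) : (forall s, t <= s <= T -> 0 <= g s) ->
  intL T t g l <= 0.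
Proof.
move=> g0; rewrite /intL oppr_le0; apply: Rintegral_ge0 => s /=.
by rewrite in_itv/=; exact: g0.
Qed.

(** The measure has total mass 1 on [t, T], so integration does not increase the uniform
    distance. *)
Lemma intL_dist t (g g' : R -> R) e : 0 <= t <= T -> left_limit l t = 1 ->
  {within `[t, T], continuous g} -> {within `[t, T], continuous g'} ->
  (forall s, t <= s <= T -> `|g s - g' s| <= e) ->
  `|intL T t g l - intL T t g' l| <= e.
Proof.
move=> tT lt1 cg cg' gg'.
have mI : measurable (`[t, T]%classic : set (measurableTypeR R)).
  exact: measurable_itv.
have ig := stieltjes_integrable HF cg; have ig' := stieltjes_integrable HF cg'.
have iB := integrable_subr mI ig ig'.
rewrite /intL -opprD normrN -(RintegralB mI ig ig').
have := le_normr_Rintegral mI iB => /le_trans; apply.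
have -> : e = \int[nu]_(s in `[t, T]) e.
  by rewrite Rintegral_cst// (V_mass T0 hL tT lt1) mulr1.
apply: le_Rintegral => //; first exact: integrable_norm iB.
by apply: stieltjes_integrable => // x; exact: cvg_cst.
Qed.

(** The constant [c] stands for the terminal value of the obstacle. The equation enters only through
    [y t - y s], where [c] cancels and the integral of [f] over [t, s] remains. *)
Lemma payoff_decomposition (t c : R) (f y a m x : R -> R) :
  0 <= t <= T -> left_limit l t = 1 ->
  leb.-integrable `[0, T] (EFin \o f) ->
  {within `[0, T], continuous y} -> {within `[0, T], continuous a} ->
  {within `[0, T], continuous m} -> {within `[0, T], continuous x} ->
  (forall s, 0 <= s <= T ->
    y s = c + \int[leb]_(r in `[s, T]) f r + (a T - a s) - (m T - m s)) ->
  \int[leb]_(s in `[t, T]) (f s * l s) - intL T t x l =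
  y t + intL T t (fun s => y s - x s) l + intL T t (fun s => a s - a t) l
  - intL T t (fun s => m s - m t) l.
Proof.
move=> tT lt1 fi cy ca cm cx yE; case/andP: (tT) => t0 tleT.
have sub : (`[t, T]%classic : set R) `<=` `[0, T] by apply: subset_itvr; rewrite bnd_simp.
have cy' := continuous_subspaceW sub cy.
have ca' := continuous_subspaceW sub ca.
have cm' := continuous_subspaceW sub cm.
have cx' := continuous_subspaceW sub cx.
have cc k : {within `[t, T], continuous (cst k : R -> R)} by move=> z; exact: cvg_cst.
have cA : {within `[t, T], continuous (fun s => a s - a t)}.
  by move=> z; apply: cvgB; [exact: ca'|exact: cvg_cst].
have cM : {within `[t, T], continuous (fun s => m s - m t)}.
  by move=> z; apply: cvgB; [exact: cm'|exact: cvg_cst].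
have mI : measurable (`[t, T]%classic : set (measurableTypeR R)).
  exact: measurable_itv.
have iY := stieltjes_integrable HF cy'.
have iX := stieltjes_integrable HF cx'.
have iA := stieltjes_integrable HF cA.
have iM := stieltjes_integrable HF cM.
have i1 := stieltjes_integrable HF (cc (y t)).
have fit : leb.-integrable `[t, T] (EFin \o f).
  by apply: integrableS fi.
have mass : \int[nu]_(s in `[t, T]) y t = y t.
  by rewrite Rintegral_cst// (V_mass T0 hL tT lt1) mulr1.
have fub := stieltjes_fubini HF tleT fit.
have fl : \int[leb]_(r in `[t, T]) (f r * (F T - F r)) =
          \int[leb]_(r in `[t, T]) (f r * l r).
  apply: eq_Rintegral => r; rewrite inE/= in_itv/= => /andP[tr rT].
  rewrite !extL_in ?lexx ?(ltW T0) ?rT ?(le_trans t0 tr)//.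
  by rewrite (V_end hL) oppr0 add0r opprK.
have lhs : \int[nu]_(s in `[t, T]) (\int[leb]_(r in `[t, s]) f r) =
    \int[nu]_(s in `[t, T]) (((y t - y s) - (a s - a t)) + (m s - m t)).
  apply: eq_Rintegral => s; rewrite inE/= in_itv/= => /andP[ts sT].
  have sT' : 0 <= s <= T by rewrite sT (le_trans t0 ts).
  have split_f : \int[leb]_(r in `[t, T]) f r =
     \int[leb]_(r in `[t, s]) f r + \int[leb]_(r in `[s, T]) f r.
    rewrite -(@Rintegral_itv_obnd_cbnd _ s).
      rewrite -(@Rintegral_itvB _ f (BLeft t) (BRight T) s fit) ?bnd_simp//.
      by rewrite addrC subrK.
    apply: integrableS fi => //; apply: subset_itvr; rewrite bnd_simp//.
    by rewrite (le_trans t0).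
  by rewrite (yE t tT) (yE s sT') split_f; ring.
have iYB := integrable_subr mI i1 iY.
have iYA := integrable_subr mI iYB iA.
rewrite -fl -fub lhs /intL (RintegralD mI iYA iM) (RintegralB mI iYB iA).
rewrite (RintegralB mI i1 iY) (RintegralB mI iY iX) mass; ring.
Qed.

End PathIdentity.

(** * Martingale increments *)

Section SquareIntegrable.
Context {R : realType} {dO : measure_display} {O : measurableType dO}.
Variable P : probability O R.
Implicit Types f g : O -> R.

Definition sq_integrable f :=
  measurable_fun setT f /\ P.-integrable setT (EFin \o (fun w => f w ^+ 2)).

Lemma sq_integrableP f : measurable_fun setT f ->
  (\int[P]_w ((f w) ^+ 2)%:E < +oo)%E -> sq_integrable f.
Proof.
move=> mf fi; split => //; apply/integrableP; split.
  by apply/measurable_EFinP; apply: measurable_funX.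
by under eq_integral do rewrite /= ger0_norm ?sqr_ge0//.
Qed.

Lemma sq_integrable_mul f g : sq_integrable f -> sq_integrable g ->
  P.-integrable setT (EFin \o (fun w => f w * g w)).
Proof.
move=> [mf fi] [mg gi].
apply: (le_integrable measurableT _ _ (integrable_addr measurableT fi gi)).
  by apply/measurable_EFinP; apply: measurable_funM.
move=> w _ /=; rewrite lee_fin [leRHS]ger0_norm ?addr_ge0 ?sqr_ge0// normrM.
rewrite -(@real_normK _ (f w) (num_real _)) -(@real_normK _ (g w) (num_real _)).
have := sqr_ge0 (`|f w| - `|g w|); have := sqr_ge0 (`|f w| + `|g w|); nra.
Qed.

Lemma sq_integrable_bounded f (C : R) : measurable_fun setT f ->
  (forall w, `|f w| <= C) -> sq_integrable f.
Proof.
move=> mf fC; split => //.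
apply: measurable_bounded_integrable.
- exact: measurableT.
- by rewrite -ge0_fin_numE// fin_num_measure.
- by apply: measurable_funX.
- exists (C ^+ 2); split; first exact: num_real.
  move=> M CM w _ /=; apply: le_trans (ltW CM).
  by rewrite ger0_norm ?sqr_ge0// -real_normK ?num_real// lerXn2r ?nnegrE// (le_trans _ (fC w)).
Qed.

Lemma sq_integrable_integrable f : sq_integrable f ->
  P.-integrable setT (EFin \o f).
Proof.
move=> fi; have := sq_integrable_mul fi (@sq_integrable_bounded (cst 1) 1 _ _).
rewrite (_ : EFin \o _ = EFin \o f); last by apply/funext => w /=; rewrite mulr1.
by apply => // w; rewrite normr1.
Qed.

Lemma sq_integrable_mul_bounded (C : R) f g : measurable_fun setT f ->
  (forall w, `|f w| <= C) -> sq_integrable g -> sq_integrable (fun w => f w * g w).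
Proof.
move=> mf fC [mg gi]; split; first exact: measurable_funM.
apply: (le_integrable measurableT _ _ (@integrable_mulcr _ _ _ _ _ measurableT (C ^+ 2) _ gi)).
  by apply/measurable_EFinP; apply: measurable_funX; exact: measurable_funM.
move=> w _ /=; rewrite lee_fin ger0_norm ?sqr_ge0// exprMn.
rewrite ger0_norm; last exact: mulr_ge0 (sqr_ge0 _) (sqr_ge0 _).
apply: ler_wpM2r; first exact: sqr_ge0.
by rewrite -real_normK ?num_real// lerXn2r ?nnegrE// (le_trans _ (fC w)).
Qed.

Lemma sq_integrableD f g : sq_integrable f -> sq_integrable g ->
  sq_integrable (fun w => f w + g w).
Proof.
move=> fi gi; have fgi := sq_integrable_mul fi gi.
case: fi gi => [mf fi] [mg gi]; split; first exact: measurable_funD.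
have := integrable_addr measurableT (integrable_addr measurableT fi gi)
  (@integrable_mulcr _ _ _ _ _ measurableT 2 _ fgi).
apply: eq_integrable => // w _ /=; congr EFin; ring.
Qed.

Lemma sq_integrableZ c f : sq_integrable f -> sq_integrable (fun w => c * f w).
Proof. by apply: (@sq_integrable_mul_bounded `|c| (cst c)). Qed.

Lemma sq_integrableB f g : sq_integrable f -> sq_integrable g ->
  sq_integrable (fun w => f w - g w).
Proof.
move=> fi gi; have := sq_integrableD fi (sq_integrableZ (-1) gi).
by congr sq_integrable; apply/funext => w; rewrite mulN1r.
Qed.

Lemma sq_integrable0 : sq_integrable (fun=> 0).
Proof. by apply: (@sq_integrable_bounded _ 0) => // w; rewrite normr0. Qed.

Lemma sq_integrable_sum (I : Type) (s : seq I) (h : I -> O -> R) :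
  (forall i, sq_integrable (h i)) -> sq_integrable (fun w => \sum_(i <- s) h i w).
Proof.
move=> hi; elim: s => [|i s IH].
  by rewrite (_ : (fun _ => _) = (fun=> 0)); [exact: sq_integrable0|apply/funext => w; rewrite big_nil].
rewrite (_ : (fun _ => _) = (fun w => h i w + \sum_(j <- s) h j w)).
  exact: sq_integrableD.
by apply/funext => w; rewrite big_cons.
Qed.

End SquareIntegrable.

(** * Vanishing conditional expectations *)

Section Centered.
Context {R : realType} {dO : measure_display} {O : measurableType dO}.
Variable P : probability O R.
Implicit Types (H : set (set O)) (D : O -> R).

(* The conditional expectation of D given the sigma-algebra generated by H
   vanishes. *)
Definition centered H D := P.-integrable setT (EFin \o D) /\
  forall B, <<s H>> B -> \int[P]_(w in B) D w = 0.

Lemma sub_sigma_measurable H : H `<=` measurable -> <<s H>> `<=` measurable.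
Proof. by move=> Hm; apply: smallest_sub => //; exact: sigma_algebra_measurable. Qed.

Lemma sub_sigma_measurable_fun H {dV} {V : measurableType dV} (f : O -> V) :
  H `<=` measurable ->
  measurable_fun setT (f : g_sigma_algebraType H -> V) -> measurable_fun setT f.
Proof.
move=> Hm mf _ B mB; have := mf measurableT B mB.
by move=> h; exact: (sub_sigma_measurable Hm h).
Qed.

Lemma sub_sigma_measurable_funS H H' {dV} {V : measurableType dV} (f : O -> V) :
  <<s H>> `<=` <<s H'>> ->
  measurable_fun setT (f : g_sigma_algebraType H -> V) ->
  measurable_fun setT (f : g_sigma_algebraType H' -> V).
Proof. by move=> HH' mf _ B mB; have /HH' := mf measurableT B mB. Qed.

(** The tower property. *)
Lemma centeredS H H' D : <<s H>> `<=` <<s H'>> -> centered H' D -> centered H D.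
Proof. by move=> HH' [Di D0]; split => // B /HH'; exact: D0. Qed.

Lemma centered0 H : centered H (fun=> 0).
Proof.
split; first exact: integrable0.
by move=> B _; rewrite /Rintegral integral0.
Qed.

Lemma centeredD H D D' : H `<=` measurable ->
  centered H D -> centered H D' -> centered H (fun w => D w + D' w).
Proof.
move=> Hm [Di D0] [Di' D0']; split; first exact: integrable_addr.
move=> B HB; have mB := sub_sigma_measurable Hm HB.
rewrite RintegralD ?D0 ?D0' ?addr0//; exact: integrableS (Di) + exact: integrableS Di'.
Qed.

Lemma centered_sum H (I : Type) (s : seq I) (h : I -> O -> R) : H `<=` measurable ->
  (forall i, centered H (h i)) -> centered H (fun w => \sum_(i <- s) h i w).
Proof.
move=> Hm hi; elim: s => [|i s IH].
  by rewrite (_ : (fun _ => _) = (fun=> 0)); [exact: centered0|apply/funext => w; rewrite big_nil].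
rewrite (_ : (fun _ => _) = (fun w => h i w + \sum_(j <- s) h j w)).
  exact: centeredD.
by apply/funext => w; rewrite big_cons.
Qed.

End Centered.

Section CenteredProduct.
Context {R : realType} {dO : measure_display} {O : measurableType dO}.
Variable P : probability O R.
Variable H : set (set O).
Hypothesis Hm : H `<=` measurable.
Implicit Types (D Q : O -> R).

Import HBNNSimple.

Let nnsfun_integral0 (D : O -> R) (g : {nnsfun (g_sigma_algebraType H) >-> R}) :
  centered P H D -> P.-integrable setT (EFin \o (fun w => g w * D w)) /\
    \int[P]_w (g w * D w) = 0.
Proof.
move=> [Di D0].
have indicE_ (A : set O) : <<s H>> A ->
    P.-integrable setT (EFin \o (fun w => \1_A w * D w)) /\
    \int[P]_w (\1_A w * D w) = 0.
  move=> HA; have mA := sub_sigma_measurable Hm HA.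
  have E : (fun w => \1_A w * D w) = D \_ A.
    by apply/funext => w; rewrite patchE indicE; case: ifPn => _; rewrite ?mul1r ?mul0r.
  rewrite E -Rintegral_mkcond D0//; split => //.
  rewrite -restrict_EFin; apply: (integrable_mkcond _ mA).1.
  exact: integrableS Di.
have gE w : g w * D w = \sum_(y <- finmap.enum_fset (fset_set (range g)))
     (y * (\1_(g @^-1` [set y]) w * D w)).
  rewrite {1}fimfunE fsbig_finite//= mulr_suml.
  by apply: eq_bigr => y _; rewrite mulrA.
have -> : (fun w => g w * D w) = (fun w => \sum_(y <- finmap.enum_fset (fset_set (range g)))
     (y * (\1_(g @^-1` [set y]) w * D w))).
  exact/funext.
elim: (finmap.enum_fset _) => [|y s [IHi IH0]].
  under [X in EFin \o X]eq_fun do rewrite big_nil.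
  under [X in Rintegral _ _ X]eq_fun do rewrite big_nil.
  by split; [exact: integrable0|rewrite /Rintegral integral0].
under [X in EFin \o X]eq_fun do rewrite big_cons.
under [X in Rintegral _ _ X]eq_fun do rewrite big_cons.
have [Ai A0] := indicE_ (g @^-1` [set y]) (measurable_funPTI g (measurable_set1 y)).
have yAi := @integrable_mulcr _ _ _ P _ measurableT y _ Ai.
split; first exact: integrable_addr.
by rewrite RintegralD// RintegralZl// A0 IH0 mulr0 addr0.
Qed.

Let centered_mul_ge0 D Q : centered P H D ->
  measurable_fun setT (Q : g_sigma_algebraType H -> R) -> (forall w, 0 <= Q w) ->
  P.-integrable setT (EFin \o (fun w => Q w * D w)) ->
  \int[P]_w (Q w * D w) = 0.
Proof.
move=> cD mQ Q0 QDi.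
have meQ : measurable_fun setT (EFin \o (Q : g_sigma_algebraType H -> R)).
  exact/measurable_EFinP.
pose g := nnsfun_approx measurableT meQ.
have g_cvg w : g n w @[n --> \oo] --> Q w.
  have : EFin \o g ^~ w @ \oo --> (Q w)%:E.
    by apply: (cvg_nnsfun_approx measurableT meQ) => //= x _; rewrite lee_fin.
  by move/fine_cvgP => [_].
have g_le n w : g n w <= Q w.
  rewrite -lee_fin /g nnsfun_approxE.
  by apply: (@le_approx _ _ _ setT (EFin \o Q)) => //= x _; rewrite lee_fin.
have [gDi gD0] := all_and2 (fun n => nnsfun_integral0 (g n) cD).
have cvg_ae : {ae P, forall w, setT w ->
    (fun n => (g n w * D w)%:E) @ \oo --> (Q w * D w)%:E}.
  apply: aeW => w _; apply: cvg_EFin; first exact: nearW.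
  by apply: cvgM => //; exact: cvg_cst.
have dom_ae : {ae P, forall w n, setT w -> (`|(g n w * D w)%:E| <= `|Q w * D w|%:E)%E}.
  apply: aeW => w n _ /=; rewrite lee_fin !normrM ler_wpM2r//.
  by rewrite !ger0_norm.
have [_ _] := dominated_convergence measurableT (fun n => measurable_int P (gDi n))
  (measurable_int P QDi) cvg_ae (integrable_norm QDi) dom_ae.
under [X in X @ _]eq_fun => n.
  rewrite (_ : \int[P]_w _ = 0)%E; last first.
    rewrite -[LHS]fineK; last exact: integrable_fin_num.
    by congr EFin; exact: gD0.
  over.
move=> /cvg_lim; rewrite lim_cst// => /(_ _)/esym h.
by rewrite /Rintegral h.
Qed.

(** Indicators of sets of the sigma-algebra satisfy this by definition; linearity gives simple
    functions, and dominated convergence with bound |Q D| gives nonnegative [Q]. A signed [Q],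
    possibly unbounded, is split into its two parts. *)
Lemma centered_mul_integral D Q : centered P H D ->
  measurable_fun setT (Q : g_sigma_algebraType H -> R) ->
  P.-integrable setT (EFin \o (fun w => Q w * D w)) ->
  \int[P]_w (Q w * D w) = 0.
Proof.
move=> cD mQ QDi.
pose Qp w := Num.max (Q w) 0; pose Qm w := Num.max (- Q w) 0.
have mQp : measurable_fun setT (Qp : g_sigma_algebraType H -> R).
  by apply: measurable_maxr => //; exact: measurable_cst.
have mQm : measurable_fun setT (Qm : g_sigma_algebraType H -> R).
  apply: measurable_maxr; last exact: measurable_cst.
  exact: (measurableT_comp (@oppr_measurable R setT) mQ).
have bound Q' : measurable_fun setT (Q' : g_sigma_algebraType H -> R) ->
    (forall w, `|Q' w| <= `|Q w|) ->
    P.-integrable setT (EFin \o (fun w => Q' w * D w)).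
  move=> mQ' Q'Q; apply: (le_integrable measurableT _ _ QDi).
    apply/measurable_EFinP; apply: measurable_funM.
      exact: sub_sigma_measurable_fun mQ'.
    by apply/measurable_EFinP; case: cD => /measurable_int.
  by move=> w _ /=; rewrite lee_fin !normrM ler_wpM2r.
have Qpi : P.-integrable setT (EFin \o (fun w => Qp w * D w)).
  apply: bound => // w; rewrite /Qp; case: (leP (Q w) 0) => //; rewrite normr0//.
have Qmi : P.-integrable setT (EFin \o (fun w => Qm w * D w)).
  apply: bound => // w; rewrite /Qm; case: (leP (- Q w) 0); rewrite ?normr0 ?normrN//.
have -> : (fun w => Q w * D w) = (fun w => Qp w * D w - Qm w * D w).
  apply/funext => w; rewrite -mulrBl /Qp /Qm; congr (_ * _).
  have [Q0|Q0] := leP (Q w) 0.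
    by rewrite max_l ?oppr_ge0// sub0r opprK.
  by rewrite max_r ?oppr_le0 ?(ltW Q0)// subr0.
rewrite RintegralB// !centered_mul_ge0 ?subrr// => w.
  by rewrite /Qp le_max lexx orbT.
by rewrite /Qm le_max lexx orbT.
Qed.

(** Taking out what is known: for B in the sigma-algebra, Q times the indicator of B is again
    measurable for it, and the integral over B becomes one over the whole space. *)
Lemma centered_mul D Q : centered P H D ->
  measurable_fun setT (Q : g_sigma_algebraType H -> R) ->
  P.-integrable setT (EFin \o (fun w => Q w * D w)) ->
  centered P H (fun w => Q w * D w).
Proof.
move=> cD mQ QDi; split => // B HB.
have mB := sub_sigma_measurable Hm HB.
rewrite Rintegral_mkcond.
have E : (fun w => Q w * D w) \_ B = (fun w => (Q w * \1_B w) * D w).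
  by apply/funext => w; rewrite patchE indicE; case: ifPn => _;
    rewrite ?mulr1 ?mulr0 ?mul0r.
rewrite E; apply: centered_mul_integral => //.
  by apply: measurable_funM => //; exact: measurable_indic.
by rewrite -E -restrict_EFin; apply: (integrable_mkcond _ mB).1; exact: integrableS QDi.
Qed.

End CenteredProduct.

(** * Brownian increments and Ito integrals *)

Section Density.
Local Open Scope ereal_scope.
Context d (T : measurableType d) (R : realType).
Variables (mu nu : {measure set T -> \bar R}) (p : T -> R).
Hypotheses (mp : measurable_fun setT p) (p0 : forall x, (0 <= p x)%R).
Hypothesis nuE : forall A, measurable A -> nu A = \int[mu]_(x in A) (p x)%:E.

Import HBNNSimple.

(** On simple functions this is linearity together with [nuE]; monotone convergence does the
    rest. *)
Lemma ge0_integral_density (f : T -> \bar R) : measurable_fun setT f ->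
  (forall x, 0 <= f x) -> \int[nu]_x f x = \int[mu]_x (f x * (p x)%:E).
Proof.
move=> mf f0; have mep : measurable_fun setT (EFin \o p) by exact/measurable_EFinP.
pose f_ := nnsfun_approx measurableT mf.
have f_cvg x : EFin \o f_ ^~ x @ \oo --> f x.
  exact: (cvg_nnsfun_approx measurableT mf).
transitivity (limn (fun n => \int[nu]_x (f_ n x)%:E)).
  rewrite -monotone_convergence//.
  - by apply: eq_integral => y _; apply/esym/cvg_lim => //; exact: f_cvg.
  - by move=> n; exact/measurable_EFinP/measurable_funP.
  - by move=> n y _; rewrite lee_fin.
  - by move=> y _ m n mn; rewrite lee_fin; exact/lefP/nd_nnsfun_approx.
rewrite [X in limn X](_ : _ =
    (fun n => \int[mu]_x ((f_ n x)%:E * (p x)%:E))).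
  rewrite -monotone_convergence//; last 3 first.
    - move=> n /=; apply: emeasurable_funM => //.
      exact/measurable_EFinP.
    - by move=> n x _ /=; rewrite mule_ge0 ?lee_fin.
    - move=> x _ m n mn; rewrite lee_wpmul2r ?lee_fin//.
      exact/lefP/nd_nnsfun_approx.
  apply: eq_integral => x _ /=; apply/cvg_lim => //.
  by apply: cvgeZr => //; exact: f_cvg.
apply/funext => n.
have mA r : measurable (f_ n @^-1` [set r]) by exact: measurable_funPTI.
rewrite integralT_nnsfun sintegralE.
transitivity (\int[mu]_x (\sum_(k \in range (f_ n)) (k%:E * (\1_(f_ n @^-1` [set k]) x)%:E * (p x)%:E))).
  rewrite ge0_integral_fsum//; last 2 first.
  - move=> r; apply: emeasurable_funM => //; apply: emeasurable_funM => //.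
    exact/measurable_EFinP.
  - by move=> r x _; rewrite mule_ge0 ?nnfun_muleindic_ge0 ?lee_fin.
  apply: eq_fsbigr => r; rewrite inE/= => -[y _ yr].
  under eq_integral do rewrite -muleA.
  rewrite ge0_integralZl//; last 3 first.
  - by apply: emeasurable_funM => //; exact/measurable_EFinP.
  - by move=> x _; rewrite mule_ge0 ?lee_fin.
  - by rewrite lee_fin -yr.
  rewrite nuE// [in LHS]integral_mkcond; congr (_ * _).
  apply: eq_integral => x _; rewrite patchE indicE.
  by case: ifPn => _; rewrite ?mul1e ?mul0e.
apply: eq_integral => x _.
rewrite [in RHS]fimfunE -fsumEFin//.
rewrite !fsbig_finite// ge0_sume_distrl//=.
by move=> k _; rewrite nnfun_muleindic_ge0.
Qed.

End Density.

(** * First and second moments of a centred Gaussian variable *)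

Section Gaussian.
Context {R : realType}.
Local Notation leb := (@lebesgue_measure R).

Lemma ge0_integral_lebesgueN (g : R -> \bar R) : measurable_fun setT g ->
  (forall x, (0 <= g x)%E) -> (\int[leb]_x g (- x)%R = \int[leb]_x g x)%E.
Proof.
move=> mg g0.
have := @ge0_integral_pushforward _ _ _ (measurableTypeR R) R
  (-%R : measurableTypeR R -> measurableTypeR R) (@oppr_measurable R setT) leb setT g
  measurableT mg (fun x _ => g0 x).
rewrite preimage_setT /= => <-.
by apply: eq_measure_integral => A mA _; exact: lebesgue_measureN.
Qed.

Lemma normal_pdfN (s x : R) : s != 0 -> normal_pdf 0 s (- x) = normal_pdf 0 s x.
Proof. by move=> s0; rewrite !normal_pdfE// /normal_fun !subr0 sqrrN. Qed.

(** A comparison that gives a finite second moment. With y = 3 x^2 / (8 s^2), the quotient of the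
    exponentials for the deviations s and 2 s is exp(-y), and x^2 = (8 s^2 / 3) y; so the claim
    reduces to y <= exp y. *)
Lemma sqr_normal_pdf_le (s x : R) : s != 0 ->
  x ^+ 2 * normal_pdf 0 s x <=
  (8 * s ^+ 2 / 3 * normal_peak s / normal_peak (2 * s)) * normal_pdf 0 (2 * s) x.
Proof.
move=> s0; have s20 : 2 * s != 0 by rewrite mulf_neq0.
have sp : 0 < s ^+ 2 by rewrite exprn_even_gt0.
rewrite !normal_pdfE// /normal_fun !subr0.
have p2 := normal_peak_gt0 s20; have p1 := normal_peak_gt0 s0.
rewrite -[leRHS]mulrA (mulrA _ (normal_peak (2 * s))) mulVf ?gt_eqF// mul1r.
rewrite [leLHS](_ : _ = x ^+ 2 * expR (- x ^+ 2 / (s ^+ 2 *+ 2)) * normal_peak s); last by ring.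
rewrite [leRHS](_ : _ = 8 * s ^+ 2 / 3 * expR (- x ^+ 2 / ((2 * s) ^+ 2 *+ 2)) * normal_peak s); last by ring.
rewrite ler_wpM2r ?(ltW p1)//.
have -> : - x ^+ 2 / (s ^+ 2 *+ 2) = - (3 * x ^+ 2 / (8 * s ^+ 2)) + - x ^+ 2 / ((2 * s) ^+ 2 *+ 2).
  by field.
rewrite expRD mulrA ler_wpM2r ?expR_ge0// expRN ler_pdivrMr ?expR_gt0//.
set y := 3 * x ^+ 2 / (8 * s ^+ 2).
have -> : x ^+ 2 = 8 * s ^+ 2 / 3 * y by rewrite /y; field.
apply: ler_wpM2l; first by rewrite divr_ge0// mulr_ge0// ltW.
by apply: le_trans (expR_ge1Dx y); rewrite lerDr.
Qed.

Context {dO : measure_display} {O : measurableType dO}.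
Variables (P : probability O R) (D : O -> R) (s : R).
Hypotheses (s0 : s != 0) (mD : measurable_fun setT D).
Hypothesis DE : forall C, measurable C -> P (D @^-1` C) = normal_prob 0 s C.

Let integral_normal (f : R -> \bar R) : measurable_fun setT f ->
  (forall x, (0 <= f x)%E) ->
  (\int[P]_w f (D w) = \int[leb]_x (f x * (normal_pdf 0 s x)%:E))%E.
Proof.
move=> mf f0.
have := @ge0_integral_pushforward _ _ _ (measurableTypeR R) R
  D mD P setT f measurableT mf (fun x _ => f0 x).
rewrite preimage_setT /= => <-.
rewrite -(@ge0_integral_density _ (measurableTypeR R) R leb (normal_prob 0 s))//.
  by apply: eq_measure_integral => A mA _; exact: DE.
- exact: measurable_normal_pdf.
- by move=> x; exact: normal_pdf_ge0.
Qed.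

Lemma gaussian_sq_integrable : sq_integrable P D.
Proof.
apply: sq_integrableP => //.
have m2 : measurable_fun setT (fun x : R => (x ^+ 2)%:E).
  by apply/measurable_EFinP; exact: measurable_funX.
rewrite (@integral_normal (fun x => (x ^+ 2)%:E))//; last first.
  by move=> x; rewrite lee_fin sqr_ge0.
set K := 8 * s ^+ 2 / 3 * normal_peak s / normal_peak (2 * s).
have s20 : 2 * s != 0 by rewrite mulf_neq0.
apply: (@le_lt_trans _ _ (\int[leb]_x (K%:E * (normal_pdf 0 (2 * s) x)%:E))%E).
  apply: ge0_le_integral => //.
  - by move=> x _; rewrite mule_ge0// lee_fin ?sqr_ge0 ?normal_pdf_ge0.
  - by apply: emeasurable_funM => //; apply/measurable_EFinP; exact: measurable_normal_pdf.
  - by apply: emeasurable_funM => //; apply/measurable_EFinP; exact: measurable_normal_pdf.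
  - by move=> x _; rewrite -!EFinM lee_fin; exact: sqr_normal_pdf_le.
rewrite integralZl//; last exact: integrable_normal_pdf.
by rewrite integral_normal_pdf mule1 ltry.
Qed.

(** The density is even, so the positive and negative parts have equal integrals; integrability
    makes these finite and their difference 0. *)
Lemma gaussian_mean0 : \int[P]_w D w = 0.
Proof.
have mp : measurable_fun setT (fun x : R => (Num.max x 0)%:E).
  by apply/measurable_EFinP; apply: measurable_maxr => //; exact: measurable_cst.
have mn : measurable_fun setT (fun x : R => (Num.max (- x) 0)%:E).
  apply/measurable_EFinP; apply: measurable_maxr => //.
have posneg : (\int[P]_w (Num.max (D w) 0)%:E = \int[P]_w (Num.max (- D w) 0)%:E)%E.
  rewrite (@integral_normal (fun x => (Num.max x 0)%:E))//; last first.
    by move=> x; rewrite lee_fin le_max lexx orbT.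
  rewrite (@integral_normal (fun x => (Num.max (- x) 0)%:E))//; last first.
    by move=> x; rewrite lee_fin le_max lexx orbT.
  rewrite -(@ge0_integral_lebesgueN (fun x => (Num.max x 0)%:E * (normal_pdf 0 s x)%:E)%E).
  - by apply: eq_integral => x _; rewrite normal_pdfN.
  - by apply: emeasurable_funM => //; apply/measurable_EFinP; exact: measurable_normal_pdf.
  - move=> x; rewrite mule_ge0// lee_fin ?normal_pdf_ge0//.
    by rewrite le_max lexx orbT.
have Di := sq_integrable_integrable gaussian_sq_integrable.
have pE w : ((EFin \o D)^\+ w = (Num.max (D w) 0)%:E)%E.
  by rewrite funeposE EFin_max.
have nE w : ((EFin \o D)^\- w = (Num.max (- D w) 0)%:E)%E.
  by rewrite funenegE EFin_max.
have fin := integrable_neg_fin_num measurableT Di.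
rewrite /Rintegral integralE.
by rewrite (eq_integral _ _ (fun w _ => pE w)) posneg -(eq_integral _ _ (fun w _ => nE w)) subee.
Qed.

End Gaussian.

Section Independence.
Context {R : realType} {dO : measure_display} {O : measurableType dO}.
Variable P : probability O R.

(** The roles are exchanged: by independence, the indicator of B minus P B is centered for the
    sigma-algebra of D, hence orthogonal to D itself. Thus the integral of D over B is P B times the
    mean of D, which is 0. *)
Lemma indep_centered (H : set (set O)) (D : O -> R) : H `<=` measurable ->
  measurable_fun setT D -> P.-integrable setT (EFin \o D) -> \int[P]_w D w = 0 ->
  indep P (preimage_set_system setT D measurable) <<s H>> ->
  centered P H D.
Proof.
move=> Hm mD Di D0 ind; split => // B HB.
have mB := sub_sigma_measurable Hm HB.
pose HD := preimage_set_system setT D measurable.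
have HDm : HD `<=` measurable.
  by move=> _ [C mC <-]; exact: mD.
have HDs : <<s HD>> `<=` HD.
  apply: smallest_sub => //; apply: sigma_algebra_preimage.
  exact: sigma_algebra_measurable.
pose E w := \1_B w - fine (P B).
have iB : P.-integrable setT (EFin \o \1_B) by exact: integrable_indic.
have ic c : P.-integrable setT (EFin \o cst c).
  exact: finite_measure_integrable_cst.
have Ei : P.-integrable setT (EFin \o E).
  exact: (integrable_subr measurableT iB (ic _)).
have cE : centered P HD E.
  split => // A /HDs HA; have mA := HDm _ HA.
  have iBA := integrableS measurableT mA (@subsetT _ A) iB.
  have icA := integrableS measurableT mA (@subsetT _ A) (ic (fine (P B))).
  rewrite /E RintegralB// Rintegral_cst//.
  have PAB : fine (P (A `&` B)) = fine (P A) * fine (P B).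
    by rewrite -fineM ?fin_num_measure//; congr fine; exact: ind.
  by rewrite {1}/Rintegral integral_indic// setIC PAB mulrC subrr.
have mDH : measurable_fun setT (D : g_sigma_algebraType HD -> R).
  by move=> _ C mC; apply: sub_sigma_algebra; exists C.
have DBi : P.-integrable setT (EFin \o (fun w => \1_B w * D w)).
  rewrite (_ : (fun w => _) = D \_ B).
    by rewrite -restrict_EFin; apply: (integrable_mkcond _ mB).1; exact: integrableS Di.
  by apply/funext => w; rewrite patchE indicE; case: ifPn => _; rewrite ?mul1r ?mul0r.
have DEE : (fun w => D w * E w) = (fun w => \1_B w * D w - fine (P B) * D w).
  by apply/funext => w; rewrite /E; ring.
have DcI := @integrable_mulcr _ _ _ P _ measurableT (fine (P B)) _ Di.
have DEi : P.-integrable setT (EFin \o (fun w => D w * E w)).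
  by rewrite DEE; exact: integrable_subr.
have := centered_mul_integral HDm cE mDH DEi.
rewrite DEE RintegralB// RintegralZl// D0 mulr0 subr0 => <-.
rewrite Rintegral_mkcond; congr (Rintegral _ _ _).
by apply/funext => w; rewrite patchE indicE; case: ifPn => _; rewrite ?mul1r ?mul0r.
Qed.

End Independence.

(** * Brownian increments and the augmented filtration *)

Section BrownianFiltration.
Context {R : realType} {dO : measure_display} {O : measurableType dO}.
Context {d m : nat}.
Variables (P : probability O R) (T : R) (W : R -> O -> 'rV[R]_m).
Variable X0 : O -> 'rV[R]_d.
Hypotheses (hP : measure_is_complete P) (hW : brownian_motion P T W).
Hypotheses (hX0 : measurable_fun setT X0).
Hypothesis hindep : indep P (preimage_set_system setT X0 measurable) <<s past W T>>.

Local Notation G := (filtration P W X0).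

Lemma past_measurable t : t <= T -> past W t `<=` measurable.
Proof.
move=> tT A [s /= ]; rewrite in_itv/= => /andP[s0 st] [C mC <-].
by apply: (bm_measurable hW) => //; rewrite s0 (le_trans st).
Qed.

Lemma filtration_measurable t : t <= T -> G t `<=` measurable.
Proof.
move=> tT A [[[C mC <-]|pA]|nA]; [exact: hX0|exact: past_measurable pA|exact: hP].
Qed.

Lemma past_le s t : s <= t -> past W s `<=` past W t.
Proof.
move=> st; apply: bigcup_subset => u /=; rewrite !in_itv/= => /andP[-> us].
exact: le_trans us st.
Qed.

Lemma filtration_le s t : s <= t -> <<s G s>> `<=` <<s G t>>.
Proof.
move=> st; apply: sub_smallest2r; first exact: smallest_sigma_algebra.
move=> A [[XA|pA]|nA]; [by left; left|left; right|by right].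
exact: past_le pA.
Qed.

Lemma coord_measurable (n : nat) (j : 'I_n) :
  measurable_fun setT (fun x : 'rV[R]_n => x 0 j).
Proof.
apply: (measurability _ (RGenOpens.measurableE R)) => _ [_ [x [y ->]] <-].
rewrite setTI; apply: sub_sigma_algebra.
have /continuousP := @coord_continuous R 1 n 0 j; apply.
exact: interval_open.
Qed.

Section Increment.
Variables (u v : R) (j : 'I_m).
Hypotheses (u0 : 0 <= u) (uv : u < v) (vT : v <= T).
Let D w := W v w 0 j - W u w 0 j.

Let u_itv : 0 <= u <= T.
Proof. by rewrite u0 (le_trans (ltW uv)). Qed.
Let v_itv : 0 <= v <= T.
Proof. by rewrite vT (le_trans u0 (ltW uv)). Qed.

Let past_coord s : 0 <= s <= T ->
  measurable_fun setT ((fun w => W s w 0 j) : g_sigma_algebraType (past W T) -> R).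
Proof.
move=> sT; have mW : measurable_fun setT (W s : g_sigma_algebraType (past W T) -> _).
  move=> _ C mC; apply: sub_sigma_algebra; exists s; first by rewrite /= in_itv.
  by exists C.
exact: measurableT_comp (coord_measurable j) mW.
Qed.

Let D_past : measurable_fun setT (D : g_sigma_algebraType (past W T) -> R).
Proof. by apply: measurable_funB; exact: past_coord. Qed.

Let mD : measurable_fun setT D.
Proof. exact: (sub_sigma_measurable_fun (past_measurable (lexx T)) D_past). Qed.

Let preimage_D C : measurable C ->
  preimage_set_system setT (fun w => W v w - W u w) measurable (D @^-1` C).
Proof.
move=> mC; exists ((fun x : 'rV[R]_m => x 0 j) @^-1` C).
  by rewrite -[X in measurable X]setTI; exact: coord_measurable.
by rewrite setTI; apply/seteqP; split => w /=; rewrite !mxE.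
Qed.

Let D_law C : measurable C -> P (D @^-1` C) = normal_prob 0 (Num.sqrt (v - u)) C.
Proof.
(* All coordinates but j are left unconstrained, which reduces the product of the marginal laws to a
   single factor. *)
move=> mC; have := bm_gaussian hW u0 uv vT (B := fun i => if i == j then C else setT).
rewrite (bigD1 j)//= eqxx big1 ?mule1; last first.
  by move=> i /negbTE ->; rewrite probability_setT.
move=> <-; last by move=> i; case: ifP.
congr (P _); apply/seteqP; split => w /=.
  by move=> DC i; case: ifP => // /eqP ->; rewrite !mxE.
by move=> /(_ j); rewrite eqxx !mxE.
Qed.

Lemma increment_sq_integrable : sq_integrable P D.
Proof.
apply: (gaussian_sq_integrable (s := Num.sqrt (v - u))) => //.
by rewrite sqrtr_eq0 -ltNge subr_gt0.
Qed.

(* X0, the past and the null sets generate F_u; the sets of the form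
   {X0 in C} /\ B with B in the past, together with the null sets, form a
   pi-system generating the same sigma-algebra. *)
Lemma increment_indep :
  indep P (preimage_set_system setT D measurable) <<s G u>>.
Proof.
move=> _ B [C mC <-] GB; rewrite setTI; set A := D @^-1` C.
have uT : u <= T by case/andP: u_itv.
have mA : measurable A by rewrite /A -[X in measurable X]setTI; exact: mD.
pose Pi : set (set O) := [set Q | exists B1 B2,
  [/\ preimage_set_system setT X0 measurable B1, <<s past W u>> B2 & Q = B1 `&` B2]]
  `|` [set N | P.-negligible N].
have mX0 B1 : preimage_set_system setT X0 measurable B1 -> measurable B1.
  by move=> [? ? <-]; exact: hX0.
have mpast B2 : <<s past W u>> B2 -> measurable B2.
  by apply: sub_sigma_measurable; exact: past_measurable.
have Pim : Pi `<=` measurable.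
  by move=> Q [[B1 [B2 [/mX0 ? /mpast ? ->]]]|/hP//]; exact: measurableI.
have X0T : preimage_set_system setT X0 measurable setT.
  by exists setT => //; rewrite setTI preimage_setT.
have pastT : <<s past W u>> setT.
  exact: (@measurableT _ (g_sigma_algebraType (past W u))).
have PiT : Pi setT by left; exists setT, setT; split => //; rewrite setTI.
have GPi : <<s G u>> `<=` <<s Pi>>.
  apply: sub_smallest2r; first exact: smallest_sigma_algebra.
  move=> Q [[XQ|pQ]|nQ]; [| |by right].
    by left; exists Q, setT; split => //; rewrite setIT.
  left; exists setT, Q; split => //; last by rewrite setTI.
  exact: sub_sigma_algebra.
have pastuT : <<s past W u>> `<=` <<s past W T>>.
  apply: sub_smallest2r; first exact: smallest_sigma_algebra.
  exact: past_le.
have PiI : setI_closed Pi.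
  move=> Q1 Q2 [[B1 [B2 [hB1 hB2 ->]]]|nQ1]; last first.
    by move=> _; right; exact: negligibleS (@subIsetl _ _ _) nQ1.
  move=> [[B1' [B2' [hB1' hB2' ->]]]|nQ2]; last first.
    by right; exact: negligibleS (@subIsetr _ _ _) nQ2.
  left; exists (B1 `&` B1'), (B2 `&` B2'); split.
  - case: hB1 hB1' => [C1 mC1 <-] [C2 mC2 <-].
    exists (C1 `&` C2); first exact: measurableI.
    by rewrite !setTI preimage_setI.
  - exact: (@measurableI _ (g_sigma_algebraType (past W u))).
  - by rewrite setIACA.
(* [mscale r] is multiplication of P by the number P A. It is compared with the restriction of P to
   A: two finite measures that agree on the pi-system agree on F_u. *)
pose r : {nonneg R} := NngNum (fine_ge0 (measure_ge0 P A)).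
have rE : (r%:num)%:E = P A by rewrite /= fineK// fin_num_measure.
have pastA : <<s past W T>> A.
  by rewrite /A -[X in <<s _>> X]setTI; exact: D_past.
have agree Q : Pi Q -> mrestr P mA Q = mscale r P Q.
  rewrite /mrestr /mscale rE => -[[B1 [B2 [hB1 hB2 ->]]]|nQ]; last first.
    have mQ := hP nQ; have PQ0 : P Q = 0%E by exact: measure_negligible.
    have PQA : P (Q `&` A) = 0%E.
      apply: measure_negligible; first exact: measurableI.
      exact: negligibleS (@subIsetl _ _ _) nQ.
    exact: etrans PQA (esym (etrans (congr1 (fun z => (P A * z)%E) PQ0) (mule0 _))).
  have pB2A : <<s past W T>> (B2 `&` A).
    apply: (@measurableI _ (g_sigma_algebraType (past W T))) => //.
    exact: pastuT.
  (* X0 is independent of W up to T, so A, which lies in the past of T but not of u, can be kept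
     with B2 while B1 is split off; A is then separated from B2 by independence of increments. *)
  have E1 : (P (B1 `&` (B2 `&` A)) = P B1 * P (B2 `&` A))%E by exact: hindep.
  have E2 : (P (B1 `&` B2) = P B1 * P B2)%E by apply: hindep => //; exact: pastuT.
  have E3 : (P (B2 `&` A) = P B2 * P A)%E.
    exact: (bm_independent hW u0 uv vT hB2 (preimage_D mC)).
  rewrite -setIA; transitivity (P B1 * (P B2 * P A))%E; first by rewrite -E3; exact: E1.
  by rewrite muleA muleC; congr (_ * _)%E; exact/esym/E2.
have cover : \bigcup_(k in @setT nat) (@setT O) = setT by rewrite bigcup_const//; exists 0%N.
have fin (k : nat) : (mrestr P mA setT < +oo)%E.
  by rewrite /mrestr setTI -ge0_fin_numE//; exact: fin_num_measure.
have := g_sigma_algebra_measure_unique Pi Pim (fun=> setT) (fun=> PiT) cover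
  (mrestr P mA) (mscale r P) PiI agree fin B (GPi _ GB).
have scaleE : mscale r P B = (P A * P B)%E by rewrite /mscale rE.
rewrite setIC -scaleE => <-.
by [].
Qed.

Lemma increment_centered : centered P (G u) D.
Proof.
have uT : u <= T by case/andP: u_itv.
apply: indep_centered => //.
- exact: filtration_measurable.
- exact: sq_integrable_integrable increment_sq_integrable.
- apply: (gaussian_mean0 (s := Num.sqrt (v - u))) => //.
  by rewrite sqrtr_eq0 -ltNge subr_gt0.
- exact: increment_indep.
Qed.

End Increment.
End BrownianFiltration.

Section SquareIntegrableLimits.
Context {R : realType} {dO : measure_display} {O : measurableType dO}.
Variable P : probability O R.

(** From |X| <= e + X^2 / e. A small second moment forces small integrals, uniformly in B. *)
Lemma normr_Rintegral_sq (X : O -> R) (B : set O) (e : R) : measurable B -> 0 < e ->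
  sq_integrable P X ->
  `|\int[P]_(w in B) X w| <= e + (\int[P]_w (X w ^+ 2)) / e.
Proof.
move=> mB e0 X2; have Xi := sq_integrable_integrable X2.
have XB := integrableS measurableT mB (@subsetT _ B) Xi.
apply: (le_trans (le_normr_Rintegral mB XB)).
have ei : P.-integrable setT (EFin \o cst e) by exact: finite_measure_integrable_cst.
have X2e := @integrable_mulcr _ _ _ P _ measurableT e^-1 _ X2.2.
have bound := integrable_addr measurableT ei X2e.
have -> : e + (\int[P]_w (X w ^+ 2)) / e =
    \int[P]_w (e + e^-1 * X w ^+ 2).
  rewrite (RintegralD measurableT ei X2e).
  rewrite Rintegral_cst// (RintegralZl _ measurableT X2.2).
  have P1 : fine (P setT) = 1 by rewrite probability_setT.
  by rewrite P1 mulr1 [e^-1 * _]mulrC.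
rewrite Rintegral_mkcond; apply: le_Rintegral => //.
- rewrite -restrict_EFin; apply: (integrable_mkcond _ mB).1.
  exact: integrable_norm XB.
- move=> w _; have h : `|X w| <= e + e^-1 * X w ^+ 2.
    rewrite -(ler_pM2l e0) mulrDr mulVKf ?gt_eqF// -(@real_normK _ (X w)) ?num_real//.
    by have := sqr_ge0 (`|X w| - e); have := sqr_ge0 (`|X w|); nra.
  rewrite patchE; case: ifPn => // _.
  by rewrite addr_ge0 ?(ltW e0)// mulr_ge0 ?sqr_ge0// invr_ge0 ltW.
Qed.

(** Convergence to 0 in the extended reals makes the second moments finite only from some index on,
    whence [near]. *)
Lemma sq_integrable_cvg0 (X : nat -> O -> R) :
  (forall n, measurable_fun setT (X n)) ->
  (fun n => \int[P]_w ((X n w) ^+ 2)%:E)%E @ \oo --> 0%E ->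
  (\forall n \near \oo, sq_integrable P (X n)) /\
  (fun n => \int[P]_w ((X n w) ^+ 2)) @ \oo --> (0 : R).
Proof.
move=> mX /fine_cvgP[fX X0]; split => //.
apply: filterS fX => n fn; apply: sq_integrableP => //.
by rewrite -ge0_fin_numE//; apply: integral_ge0 => w _; rewrite lee_fin sqr_ge0.
Qed.

End SquareIntegrableLimits.

(** * The martingale property of the Ito integral *)

Section ItoMartingale.
Context {R : realType} {dO : measure_display} {O : measurableType dO}.
Context {d m : nat}.
Variables (P : probability O R) (T : R) (W : R -> O -> 'rV[R]_m).
Variable X0 : O -> 'rV[R]_d.
Hypotheses (hP : measure_is_complete P) (hW : brownian_motion P T W).
Hypotheses (hX0 : measurable_fun setT X0).
Hypothesis hindep : indep P (preimage_set_system setT X0 measurable) <<s past W T>>.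

Local Notation G := (filtration P W X0).

Let increment2 (a b : R) (j : 'I_m) : 0 <= a -> a <= b -> b <= T ->
  sq_integrable P (fun w => W b w 0 j - W a w 0 j).
Proof.
move=> a0; rewrite le_eqVlt => /predU1P[<- _|ab bT].
  under eq_fun do rewrite subrr; exact: sq_integrable0.
by apply: (increment_sq_integrable hW).
Qed.

Lemma bounded_increment_centered (a b : R) (j : 'I_m) (eta : O -> R) (C : R) :
  0 <= a -> a <= b -> b <= T ->
  measurable_fun setT (eta : g_sigma_algebraType (G a) -> R) ->
  (forall w, `|eta w| <= C) ->
  centered P (G a) (fun w => eta w * (W b w 0 j - W a w 0 j)).
Proof.
move=> a0 ab bT meta eC.
have aT := le_trans ab bT.
have Gm : G a `<=` measurable by exact: filtration_measurable hP hW hX0 _ aT.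
have metaO := sub_sigma_measurable_fun Gm meta.
apply: centered_mul => //.
  move: ab; rewrite le_eqVlt => /predU1P[<-|ab].
    under eq_fun do rewrite subrr; exact: centered0.
  exact: (increment_centered hP hW hX0 hindep).
apply: sq_integrable_integrable; apply: (sq_integrable_mul_bounded metaO eC).
exact: increment2.
Qed.

Lemma enorm_coord (n : nat) (x : 'rV[R]_n) (j : 'I_n) : `|x 0 j| <= enorm x.
Proof.
rewrite /enorm big_ord1 -sqrtr_sqr ler_wsqrtr// (bigD1 j)//= lerDl.
by apply: sumr_ge0 => i _; exact: sqr_ge0.
Qed.

Section Simple.
Variables (N : nat) (tau : nat -> R) (eta : nat -> O -> 'rV[R]_m).
Hypothesis hs : simple_integrand T G N tau eta.

Let tau_itv i : (i <= N)%N -> 0 <= tau i <= T.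
Proof.
move=> iN; apply/andP; split.
  rewrite -(si_start hs); elim: i iN => // i IH iN.
  by rewrite (le_trans (IH (ltnW iN)))// (si_mono hs).
suff h k j : (j + k)%N = N -> tau j <= T by exact: h (subnKC iN).
elim: k j => [j|k IH j]; first by rewrite addn0 => ->; rewrite (si_end hs).
move=> jk; have jN : (j < N)%N by rewrite -jk -addSnnS leq_addr.
by apply: le_trans (si_mono hs jN) (IH _ _); rewrite addSnnS.
Qed.

Let eta_measurable (i : 'I_N) j s : tau i <= s ->
  measurable_fun setT ((fun w => eta i w 0 j) : g_sigma_algebraType (G s) -> R).
Proof.
move=> ts; apply: (@sub_sigma_measurable_funS _ _ (G (tau i))).
  exact: filtration_le.
exact: measurableT_comp (coord_measurable j) (si_measurable hs (ltn_ord i)).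
Qed.

Lemma simple_integral_sq_integrable t : 0 <= t <= T ->
  sq_integrable P (simple_integral W N tau eta t).
Proof.
move=> /andP[t0 tT]; case: (si_bounded hs) => C hC.
apply: sq_integrable_sum => i; apply: sq_integrable_sum => j.
have /andP[ti0 tiT] := tau_itv (ltnW (ltn_ord i)).
have /andP[ti10 ti1T] := tau_itv (ltn_ord i).
rewrite (_ : (fun w => _) = (fun w => eta i w 0 j *
   (W (Num.min (tau i.+1) t) w 0 j - W (Num.min (tau i) t) w 0 j))); last first.
  by apply/funext => w; rewrite !mxE.
apply: (@sq_integrable_mul_bounded _ _ _ _ C).
- apply: (sub_sigma_measurable_fun (filtration_measurable hP hW hX0 tiT)).
  exact: eta_measurable.
- by move=> w; apply: le_trans (enorm_coord _ _) (hC _ _ (ltn_ord i)).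
- apply: increment2.
  + by rewrite le_min ti0.
  + by rewrite le_min !ge_min (si_mono hs (ltn_ord i)) lexx orbT.
  + by rewrite ge_min tT orbT.
Qed.

(** Clipping the partition to [u, v] gives times [r i] between which all increments take place. If
    [tau i <= v] then [tau i <= r i], so [eta i] is known at time [r i] and its term is centered
    there, hence at u; otherwise [r i] and [r i.+1] coincide. *)
Lemma simple_integral_centered u v : 0 <= u -> u <= v -> v <= T ->
  centered P (G u)
    (fun w => simple_integral W N tau eta v w - simple_integral W N tau eta u w).
Proof.
move=> u0 uv vT; case: (si_bounded hs) => C hC.
have Gu : G u `<=` measurable.
  by apply: (filtration_measurable hP hW hX0); exact: le_trans uv vT.
pose r i := Num.max u (Num.min (tau i) v).
have Wr i w j : W (Num.min (tau i) v) w 0 j - W (Num.min (tau i) u) w 0 j =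
    W (r i) w 0 j - W u w 0 j.
  rewrite /r; have [tu|ut] := leP (tau i) u.
    by rewrite (min_idPl (le_trans tu uv)) (max_idPl tu) !subrr.
  by congr (W _ _ _ _ - W _ _ _ _); rewrite (max_idPr _)// le_min (ltW ut).
rewrite (_ : (fun w => _) = (fun w => \sum_(i < N) \sum_(j < m)
   (eta i w 0 j * (W (r i.+1) w 0 j - W (r i) w 0 j)))); last first.
  apply/funext => w; rewrite /simple_integral -sumrB; apply: eq_bigr => i _.
  rewrite /dotv -sumrB; apply: eq_bigr => j _; rewrite !mxE -mulrBr; congr (_ * _).
  have := Wr i.+1 w j; have := Wr i w j; lra.
apply: centered_sum => // i; apply: centered_sum => // j.
have tii1 := si_mono hs (ltn_ord i).
have [tv|vt] := leP (tau i) v; last first.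
  have -> : r i = r i.+1.
    by rewrite /r !(min_idPr _)// ltW// (lt_le_trans vt).
  under eq_fun do rewrite subrr mulr0; exact: centered0.
have ru : u <= r i by rewrite /r le_max lexx.
apply: (@centeredS _ _ _ _ _ (G (r i))); first exact: filtration_le.
apply: (@bounded_increment_centered _ _ _ _ C).
- exact: le_trans ru.
- by rewrite /r ge_max !le_max lexx/= le_min !ge_min tii1 lexx !orbT.
- by rewrite /r ge_max (le_trans uv)//= ge_min vT orbT.
- by apply: eta_measurable; rewrite /r (min_idPl tv) le_max lexx orbT.
- by move=> w; apply: le_trans (enorm_coord _ _) (hC _ _ (ltn_ord i)).
Qed.

End Simple.

Variables (Z : R -> O -> 'rV[R]_m) (M : R -> O -> R).
Hypothesis hM : is_ito P T G W Z M.

Let M_measurable t : 0 <= t <= T -> measurable_fun setT (M t).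
Proof.
move=> tT; have [_ aM _ _] := hM; case/andP: (tT) => _ tT'.
exact: (sub_sigma_measurable_fun (filtration_measurable hP hW hX0 tT') (aM t tT)).
Qed.

(** A single simple integral at finite L^2 distance from [M t] suffices. *)
Lemma ito_sq_integrable t : 0 <= t <= T -> sq_integrable P (M t).
Proof.
move=> tT; case: hM => _ _ _ [N [tau [eta [hs _ /(_ t tT) cI]]]].
have I2 n := simple_integral_sq_integrable (hs n) tT.
have [] := sq_integrable_cvg0 _ cI.
  by move=> n; apply: measurable_funB; [exact: M_measurable|exact: (I2 n).1].
move=> [n _ /(_ n (leqnn _)) h] _.
have := sq_integrableD h (I2 n); congr sq_integrable.
by apply/funext => w; rewrite subrK.
Qed.

(** Over B the increments of the simple integrals integrate to 0, so only the approximation errors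
    at the times u and v remain, and these are controlled by their second moments. *)
Lemma ito_centered u v : 0 <= u -> u <= v -> v <= T ->
  centered P (G u) (fun w => M v w - M u w).
Proof.
move=> u0 uv vT.
have uT : 0 <= u <= T by rewrite u0 (le_trans uv).
have vT' : 0 <= v <= T by rewrite vT (le_trans u0).
have Mu := ito_sq_integrable uT; have Mv := ito_sq_integrable vT'.
have Mui := sq_integrable_integrable Mu; have Mvi := sq_integrable_integrable Mv.
split; first exact: integrable_subr.
move=> B HB; case/andP: (uT) => _ uT''.
have mB := sub_sigma_measurable (filtration_measurable hP hW hX0 uT'') HB.
case: hM => _ _ _ [N [tau [eta [hs _ cI]]]].
pose I n := simple_integral W (N n) (tau n) (eta n).
have I2 n t : 0 <= t <= T -> sq_integrable P (I n t).
  exact: simple_integral_sq_integrable.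
have DE n t : 0 <= t <= T -> sq_integrable P (fun w => M t w - I n t w).
  by move=> tT; apply: sq_integrableB (I2 n t tT); exact: ito_sq_integrable.
have cvgI t : 0 <= t <= T ->
    (fun n => \int[P]_w ((M t w - I n t w) ^+ 2)) @ \oo --> (0 : R).
  move=> tT; have [] // := sq_integrable_cvg0 (fun n => (DE n t tT).1) (cI t tT).
apply/eqP; rewrite -normr_le0; apply/ler_addgt0Pl => e e0; rewrite addr0.
(* A second moment of at most (e/4)^2, used in [normr_Rintegral_sq] with parameter e/4, gives an
   error of e/4 + e/4 at each of the two times. *)
have e4 : 0 < e / 4 by rewrite divr_gt0.
have e44 : 0 < e / 4 * (e / 4) by rewrite mulr_gt0.
have /cvgrPdist_le/(_ _ e44) hu := cvgI u uT.
have /cvgrPdist_le/(_ _ e44) hv := cvgI v vT'.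
have [n [/= hun hvn]] := filter_ex (filterI hu hv).
have bd t (tT : 0 <= t <= T) : \int[P]_w ((M t w - I n t w) ^+ 2) <= e / 4 * (e / 4) ->
    `|\int[P]_(w in B) (M t w - I n t w)| <= e / 2.
  move=> h; apply: (le_trans (normr_Rintegral_sq mB e4 (DE n t tT))).
  have : (\int[P]_w ((M t w - I n t w) ^+ 2)) / (e / 4) <= e / 4.
    by rewrite ler_pdivrMr.
  lra.
have onB (X : O -> R) : sq_integrable P X -> P.-integrable B (EFin \o X).
  by move=> /sq_integrable_integrable; apply: integrableS.
have [Ii I0] := simple_integral_centered (hs n) u0 uv vT.
have -> : \int[P]_(w in B) (M v w - M u w) =
    \int[P]_(w in B) (M v w - I n v w) - \int[P]_(w in B) (M u w - I n u w).
  rewrite -RintegralB//; [|exact/onB/DE|exact/onB/DE].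
  rewrite -[RHS]addr0 -(I0 B HB) -RintegralD//.
  - by congr (Rintegral _ _ _); apply/funext => w; rewrite /I; ring.
  - by apply: onB; apply: sq_integrableB; exact: DE.
  - exact: integrableS Ii.
rewrite (le_trans (ler_normB _ _))// (splitr e) lerD//; apply: bd => //.
- by move: hvn; rewrite sub0r normrN; apply: le_trans; exact: ler_norm.
- by move: hun; rewrite sub0r normrN; apply: le_trans; exact: ler_norm.
Qed.

End ItoMartingale.

(** * Martingale transforms *)

Section BoundedL2Limit.
Context {R : realType} {dO : measure_display} {O : measurableType dO}.
Variable P : probability O R.
Variables (X : nat -> O -> R) (Y : O -> R) (C : R).
Hypotheses (X2 : forall n, sq_integrable P (X n)).
Hypothesis XC : forall n, \int[P]_w (X n w ^+ 2) <= C.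
Hypothesis XY : forall w, X n w @[n --> \oo] --> Y w.

Let mY : measurable_fun setT Y.
Proof.
apply: (measurable_fun_cvg (fun n => (X2 n).1)) => w _; exact: XY.
Qed.

Let XeC n : (\int[P]_w (X n w ^+ 2)%:E <= C%:E)%E.
Proof.
rewrite -[leLHS]fineK; first by rewrite lee_fin; exact: XC.
by apply: integrable_fin_num => //; exact: (X2 n).2.
Qed.

(** Fatou's lemma applied to the squares. *)
Let YeC : (\int[P]_w (Y w ^+ 2)%:E <= C%:E)%E.
Proof.
have -> : (\int[P]_w (Y w ^+ 2)%:E = \int[P]_w limn_einf (fun n => (X n w ^+ 2)%:E))%E.
  apply: eq_integral => w _; apply/esym; apply: (cvg_limn_einf_sup _).1.
  apply: cvg_EFin; first exact: nearW.
  by apply: cvgM; exact: XY.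
apply: (@le_trans _ _ (limn_einf (fun n => \int[P]_w (X n w ^+ 2)%:E)%E)).
  apply: fatou => //.
  - by move=> n; apply/measurable_EFinP; apply: measurable_funX; exact: (X2 n).1.
  - by move=> n w _; rewrite lee_fin sqr_ge0.
rewrite limn_einf_lim; apply: lime_le; first exact: is_cvg_einfs.
apply: nearW => n; apply: le_trans (XeC n).
by apply: ereal_inf_lbound; exists n => /=.
Qed.

Lemma bounded_cvg_sq_integrable : sq_integrable P Y.
Proof. by apply: sq_integrableP => //; exact: le_lt_trans YeC (ltry _). Qed.

Let Y2 := bounded_cvg_sq_integrable.

Let YC : \int[P]_w (Y w ^+ 2) <= C.
Proof.
rewrite -lee_fin /Rintegral fineK//.
by apply: integrable_fin_num => //; exact: Y2.2.
Qed.

Let D n w := Y w - X n w.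

Let D2 n : sq_integrable P (D n).
Proof. exact: sq_integrableB. Qed.

Let DC n : \int[P]_w (D n w ^+ 2) <= 4 * C.
Proof.
have Yi := @integrable_mulcr _ _ _ P _ measurableT 2 _ Y2.2.
have Xi := @integrable_mulcr _ _ _ P _ measurableT 2 _ (X2 n).2.
apply: (@le_trans _ _ (\int[P]_w (2 * Y w ^+ 2 + 2 * X n w ^+ 2))).
  apply: le_Rintegral => //; first exact: (D2 n).2.
    exact: integrable_addr.
  by move=> w _; rewrite /D; have := sqr_ge0 (Y w + X n w); nra.
rewrite (RintegralD measurableT Yi Xi) (RintegralZl _ measurableT Y2.2).
rewrite (RintegralZl _ measurableT (X2 n).2).
have := XC n; have := YC; lra.
Qed.

(* Truncating at height K, the part below K converges by bounded convergence
   and the part above K is at most E[D_n^2] / K by Chebyshev. *)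
Lemma bounded_cvg_Rintegral0 B : measurable B ->
  (forall n, \int[P]_(w in B) X n w = 0) -> \int[P]_(w in B) Y w = 0.
Proof.
move=> mB X0.
have onB (Z : O -> R) : P.-integrable setT (EFin \o Z) -> P.-integrable B (EFin \o Z).
  exact: integrableS.
have C0 : 0 <= C.
  by apply: le_trans (XC 0); apply: Rintegral_ge0 => w _; exact: sqr_ge0.
apply/eqP; rewrite -normr_le0; apply/ler_addgt0Pl => e e0; rewrite addr0.
(* Chosen so that the bound 4 C on the second moment of [D n], divided by K, is at most e/2; the
   added 1 keeps K positive when C = 0. *)
pose K := 8 * (C + 1) / e.
have K0 : 0 < K by rewrite divr_gt0// mulr_gt0// ltr_wpDl.
pose m n w := Num.min `|D n w| K.
have mm n : measurable_fun setT (m n).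
  apply: measurable_minr => //; apply: measurableT_comp => //.
  exact: (D2 n).1.
have m0 n w : 0 <= m n w by rewrite le_min normr_ge0 ltW.
have mK n w : m n w <= K by rewrite ge_min lexx orbT.
have mi n : P.-integrable setT (EFin \o m n).
  apply: sq_integrable_integrable; apply: (@sq_integrable_bounded _ _ _ _ _ K) => // w.
  by rewrite ger0_norm.
have D_cvg w : D n w @[n --> \oo] --> (0 : R).
  by rewrite -(subrr (Y w)); apply: cvgB; [exact: cvg_cst|exact: XY].
have m_cvg w : m n w @[n --> \oo] --> (0 : R).
  apply: (@squeeze_cvgr _ _ _ _ (cst 0) (fun n => `|D n w|)).
  - by apply: nearW => n; rewrite m0/= /m ge_min lexx.
  - exact: cvg_cst.
  - by rewrite -[X in _ --> X](@normr0 _ R); apply: cvg_norm.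
have im : \int[P]_w m n w @[n --> \oo] --> (0 : R).
  have cvg_ae : {ae P, forall w, setT w -> (fun n => (m n w)%:E) @ \oo --> 0%E}.
    by apply: aeW => w _; apply: cvg_EFin; [exact: nearW|exact: m_cvg].
  have dom_ae : {ae P, forall w n, setT w -> (`|(m n w)%:E| <= (cst K w)%:E)%E}.
    by apply: aeW => w n _ /=; rewrite lee_fin ger0_norm.
  have [_ _] := dominated_convergence measurableT (fun n => measurable_int P (mi n))
    (measurable_cst 0%E) cvg_ae (finite_measure_integrable_cst P K measurableT) dom_ae.
  by rewrite integral0 => /fine_cvgP[].
have /cvgrPdist_le/(_ (e / 2)) := im.
rewrite divr_gt0// => /(_ isT) [n _ /(_ n (leqnn _))/=].
rewrite sub0r normrN => mn.
have Di := sq_integrable_integrable (D2 n).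
have -> : \int[P]_(w in B) Y w = \int[P]_(w in B) D n w.
  rewrite /D RintegralB// ?X0 ?subr0//; apply: onB; exact: sq_integrable_integrable.
apply: (le_trans (le_normr_Rintegral mB (onB _ Di))).
have DKi := @integrable_mulcr _ _ _ P _ measurableT K^-1 _ (D2 n).2.
(* Pointwise, |D n| is at most its truncation plus D n^2 / K: where |D n| exceeds K, the second term
   alone dominates it. *)
apply: (@le_trans _ _ (\int[P]_w (m n w + K^-1 * D n w ^+ 2))).
  rewrite Rintegral_mkcond; apply: le_Rintegral => //.
  - rewrite -restrict_EFin; apply: (integrable_mkcond _ mB).1.
    exact: integrable_norm (onB _ Di).
  - exact: integrable_addr.
  - move=> w _; have d0 : 0 <= K^-1 * D n w ^+ 2.
      by rewrite mulr_ge0 ?sqr_ge0// invr_ge0 ltW.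
    rewrite patchE; case: ifPn => _; last by rewrite addr_ge0.
    rewrite /m; have [_|KD] := leP `|D n w| K; first by rewrite lerDl.
    rewrite (@le_trans _ _ (K^-1 * D n w ^+ 2))// ?lerDr ?(ltW K0)//.
    rewrite -(@real_normK _ (D n w)) ?num_real// ler_pdivlMl// expr2.
    by rewrite ler_wpM2r// ltW.
rewrite (RintegralD measurableT (mi n) DKi) (RintegralZl _ measurableT (D2 n).2).
rewrite (splitr e) lerD//; first exact: le_trans (ler_norm _) mn.
rewrite ler_pdivrMl// (le_trans (DC n))// /K.
have -> : 8 * (C + 1) / e * (e / 2) = 4 * (C + 1) by field; rewrite gt_eqF.
by rewrite ler_pM2l// lerDl.
Qed.

End BoundedL2Limit.

Section MartingaleTransform.
Context {R : realType} {dO : measure_display} {O : measurableType dO}.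
Variables (P : probability O R) (H : nat -> set (set O)).
Variables (M l : nat -> O -> R).
Hypothesis Hm : forall i, H i `<=` measurable.
Hypothesis HS : forall i, <<s H i>> `<=` <<s H i.+1>>.
Hypothesis M_adapted : forall i,
  measurable_fun setT (M i : g_sigma_algebraType (H i) -> R).
Hypothesis M2 : forall i, sq_integrable P (M i).
Hypothesis M_centered : forall i, centered P (H i) (fun w => M i.+1 w - M i w).
Hypothesis l_adapted : forall i,
  measurable_fun setT (l i : g_sigma_algebraType (H i) -> R).
Hypothesis l1 : forall i w, `|l i w| <= 1.

Let S n w := \sum_(i < n) l i w * (M i.+1 w - M i w).

Let SS n : S n.+1 = fun w => S n w + l n w * (M n.+1 w - M n w).
Proof. by apply/funext => w; rewrite /S big_ord_recr. Qed.

Let S0 : S 0 = fun=> 0.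
Proof. by apply/funext => w; rewrite /S big_ord0. Qed.

Let up i (f : O -> R) : measurable_fun setT (f : g_sigma_algebraType (H i) -> R) ->
  measurable_fun setT (f : g_sigma_algebraType (H i.+1) -> R).
Proof. exact: sub_sigma_measurable_funS. Qed.

Let H0 i : <<s H 0>> `<=` <<s H i>>.
Proof. by elim: i => // i IH A HA; apply: HS; exact: IH. Qed.

Let D2 i : sq_integrable P (fun w => M i.+1 w - M i w).
Proof. exact: sq_integrableB. Qed.

Let lD2 i : sq_integrable P (fun w => l i w * (M i.+1 w - M i w)).
Proof.
have ml := sub_sigma_measurable_fun (@Hm i) (@l_adapted i).
exact: sq_integrable_mul_bounded ml (l1 i) (D2 i).
Qed.

Let S_adapted n : measurable_fun setT (S n : g_sigma_algebraType (H n) -> R).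
Proof.
elim: n => [|n IH]; first by rewrite S0; exact: measurable_cst.
rewrite SS; apply: measurable_funD; first exact: up.
apply: measurable_funM; first exact: up.
by apply: measurable_funB => //; exact: up.
Qed.

Lemma martingale_transform_sq_integrable n : sq_integrable P (S n).
Proof.
elim: n => [|n IH]; first by rewrite S0; exact: sq_integrable0.
by rewrite SS; exact: sq_integrableD.
Qed.
Let S2 := martingale_transform_sq_integrable.

(** Each summand is centered at its own time, hence at time 0 by the tower property. *)
Lemma martingale_transform_centered n : centered P (H 0) (S n).
Proof.
elim: n => [|n IH]; first by rewrite S0; exact: centered0.
rewrite SS; apply: centeredD => //; apply: (centeredS (@H0 n)).
by apply: centered_mul => //; exact: sq_integrable_integrable (lD2 n).
Qed.

(** The cross term vanishes because the increment is orthogonal to everything known at time n. The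
    factor [c] is kept general so as to serve both the transform ([c] equal to [l n]) and M itself
    ([c] equal to 1). *)
Let Pythagoras n (Q : O -> R) :
  measurable_fun setT (Q : g_sigma_algebraType (H n) -> R) -> sq_integrable P Q ->
  forall c : O -> R, measurable_fun setT (c : g_sigma_algebraType (H n) -> R) ->
  (forall w, `|c w| <= 1) ->
  \int[P]_w ((Q w + c w * (M n.+1 w - M n w)) ^+ 2) =
  \int[P]_w (Q w ^+ 2) + \int[P]_w ((c w * (M n.+1 w - M n w)) ^+ 2).
Proof.
move=> mQ Q2 c mc c1.
have cD2 : sq_integrable P (fun w => c w * (M n.+1 w - M n w)).
  exact: sq_integrable_mul_bounded (sub_sigma_measurable_fun (@Hm n) mc) c1 (D2 n).
have Qci := sq_integrable_mul Q2 cD2.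
have cross : \int[P]_w (Q w * (c w * (M n.+1 w - M n w))) = 0.
  apply: (centered_mul_integral (@Hm n)) => //.
  by apply: centered_mul => //; exact: sq_integrable_integrable.
have Qci2 := @integrable_mulcr _ _ _ P _ measurableT 2 _ Qci.
have sumi := integrable_addr measurableT Q2.2 cD2.2.
transitivity (\int[P]_w ((Q w ^+ 2 + (c w * (M n.+1 w - M n w)) ^+ 2) +
   2 * (Q w * (c w * (M n.+1 w - M n w))))).
  by congr (Rintegral _ _ _); apply/funext => w; ring.
rewrite (RintegralD measurableT sumi Qci2) (RintegralD measurableT Q2.2 cD2.2).
by rewrite (RintegralZl _ measurableT Qci) cross mulr0 addr0.
Qed.

(** Both second moments are built up from orthogonal increments, and |l| <= 1 makes each increment
    of the transform the smaller one. *)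
Lemma martingale_transform_le n :
  \int[P]_w (S n w ^+ 2) <= \int[P]_w ((M n w - M 0 w) ^+ 2).
Proof.
elim: n => [|n IH].
  by rewrite S0 expr0n; under [leRHS]eq_Rintegral do rewrite subrr expr0n.
have M0n : measurable_fun setT (M 0 : g_sigma_algebraType (H n) -> R).
  exact: sub_sigma_measurable_funS (@H0 n) (@M_adapted 0).
rewrite SS Pythagoras//.
have -> : \int[P]_w ((M n.+1 w - M 0 w) ^+ 2) =
    \int[P]_w (((M n w - M 0 w) + 1 * (M n.+1 w - M n w)) ^+ 2).
  by congr (Rintegral _ _ _); apply/funext => w; ring.
rewrite (@Pythagoras n _ _ _ (cst 1)); last first.
- by move=> w; rewrite normr1.
- exact: measurable_cst.
- exact: sq_integrableB.
- exact: measurable_funB.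
apply: lerD => //; apply: le_Rintegral => //.
- exact: (lD2 n).2.
- rewrite (_ : _ \o _ = EFin \o (fun w => (M n.+1 w - M n w) ^+ 2)).
    exact: (D2 n).2.
  by apply/funext => w /=; rewrite mul1r.
- move=> w _; rewrite !exprMn ler_wpM2r ?sqr_ge0//.
  by rewrite expr1n -(@real_normK _ (l n w)) ?num_real// expr_le1.
Qed.

End MartingaleTransform.

(** * Continuity of the obstacle *)

Section ObstacleContinuity.
Context {R : realType}.

(** Close to x the difference quotients are bounded by |dphi x| + 1, which gives a Lipschitz
    estimate at x; the point y = x, excluded from the quotients, is trivial. *)
Lemma C1_on_continuous (a b : R) (phi : R -> R) :
  C1_on a b phi -> {within `[a, b], continuous phi}.
Proof.
move=> [dphi _ hphi]; apply/subspace_continuousP => x xab.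
have xab' : a <= x <= b by move: xab; rewrite /= in_itv.
have /cvgrPdist_lt/(_ _ ltr01) := hphi x xab'.
rewrite nearE /within /= => /nbhs_ballP[r /= r0 hr].
apply/(@cvgrPdist_le _ _ _ _ (within_filter _ _)) => e e0; rewrite nearE /within /=.
set C := `|dphi x| + 1; have C0 : 0 < C by rewrite ltr_wpDl.
apply/nbhs_ballP; exists (Num.min r (e / C)) => /=.
  by rewrite lt_min r0 divr_gt0.
move=> y; rewrite /ball/= lt_min => /andP[xyr xye]; rewrite in_itv/= => yab.
have [->|yx] := eqVneq y x; first by rewrite subrr normr0 ltW.
have q1 := hr y xyr (conj yab yx).
have yx0 : y - x != 0 by rewrite subr_eq0.
have q : `|(phi y - phi x) / (y - x)| <= C.
  rewrite /C -[X in `|X|](subrK (dphi x)) addrC (le_trans (ler_normD _ _))// lerD2l.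
  by rewrite distrC ltW.
rewrite distrC -[X in `|X|](divfK yx0) normrM.
apply: (@le_trans _ _ (C * (e / C))); last by rewrite mulrC divfK ?gt_eqF.
by apply: ler_pM => //; rewrite distrC ltW.
Qed.

Context {dO : measure_display} {O : measurableType dO}.
Variables (P : probability O R) (T : R) (G : R -> set (set O)).
Variables (L : R -> O -> R) (phi : R -> R).
Hypotheses (T0 : 0 < T) (hL : in_V T G L).
Hypothesis Gm : forall t, 0 <= t <= T -> G t `<=` measurable.
Hypothesis cphi : {within `[- T, T], continuous phi}.

Let shift_itv t s : 0 <= t <= T -> 0 <= s <= T -> - T <= t - s <= T.
Proof. by move=> /andP[? ?] /andP[? ?]; apply/andP; split; lra. Qed.

Let left_limit0 (l : R -> R) : left_limit l 0 = 1.
Proof. by rewrite /left_limit ltxx. Qed.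

Let T00 : (0 : R) <= 0 <= T. Proof. by rewrite lexx ltW. Qed.

Let cshift t : 0 <= t <= T -> {within `[0, T], continuous (fun s => phi (t - s))}.
Proof.
move=> tT; apply/subspace_continuousP => s sI.
have sT : 0 <= s <= T by move: sI; rewrite /= in_itv.
apply/(@cvgrPdist_le _ _ _ _ (within_filter _ _)) => e e0; have [r r0 hr] := uniform_continuity_segment cphi e0.
rewrite nearE /within /=; apply/nbhs_ballP; exists r => //= s' ss'.
rewrite in_itv/= => s'T; apply: hr; [exact: shift_itv|exact: shift_itv|].
by rewrite (_ : _ - _ = s' - s); [rewrite distrC ltW|ring].
Qed.

Let J t w := intL T 0 (fun s => phi (t - s)) (fun s => L s w).

Let phi_bounded : exists C, forall x, - T <= x <= T -> `|phi x| <= C.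
Proof.
have := compact_bounded (continuous_compact cphi (@segment_compact R (- T) T)).
move=> [M [Mr hM]]; exists (M + 1) => x xT.
by apply: (hM (M + 1)); [rewrite ltrDl|exists x; rewrite //= in_itv].
Qed.

Let L_measurable t : 0 <= t <= T -> measurable_fun setT (L t).
Proof. by move=> tT; exact: sub_sigma_measurable_fun (Gm tT) (V_adapted hL tT). Qed.

Let J_measurable t : 0 <= t <= T -> measurable_fun setT (J t).
Proof.
move=> tT.
have cJ w : setT w -> (fun n => - (phi (t - 0) * (1 - L 0 w) + \sum_(i < n.+1)
     phi (t - grid 0 T n.+1 i.+1) * (L (grid 0 T n.+1 i) w - L (grid 0 T n.+1 i.+1) w)))
    @ \oo --> J t w.
  by move=> _; exact: (cvg_intL0 T0 hL (cshift tT)).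
apply: (measurable_fun_cvg _ cJ) => n; apply: measurableT_comp => //.
apply: measurable_funD.
  by apply: measurable_funM => //; apply: measurable_funB => //; exact: L_measurable.
apply: measurable_sum => i; apply: measurable_funM => //.
by apply: measurable_funB; apply: L_measurable; apply: grid_itv => //; rewrite ?ltW// ltnW.
Qed.

(** Comparison with the zero integrand through [intL_dist] bounds [J t] by a bound of |phi| on
    [-T, T]. *)
Let J_integrable t : 0 <= t <= T -> P.-integrable setT (EFin \o J t).
Proof.
move=> tT; have [C hC] := phi_bounded.
apply: sq_integrable_integrable; apply: (@sq_integrable_bounded _ _ _ _ _ C).
  exact: J_measurable.
move=> w; have I0 : intL T 0 (fun=> 0) (fun s => L s w) = 0.
  by rewrite /intL /Rintegral integral0 oppr0.
have := @intL_dist _ _ _ T G L w T0 hL 0 (fun s => phi (t - s)) (fun=> 0) C T00 (left_limit0 _).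
rewrite I0 subr0; apply.
- exact: cshift.
- by move=> x; exact: cvg_cst.
- by move=> s sT; rewrite subr0; apply: hC; exact: shift_itv.
Qed.

(** A modulus of continuity of phi on [-T, T] controls phi(t - s) - phi(t' - s) uniformly in s. Mass
    1 carries it over to [J] on every path, and P being a probability carries it over to the
    expectation. *)
Lemma expected_intL_continuous :
  {within `[0, T], continuous (fun t => \int[P]_w J t w)}.
Proof.
apply/subspace_continuousP => t tI.
have tT : 0 <= t <= T by move: tI; rewrite /= in_itv.
apply/(@cvgrPdist_le _ _ _ _ (within_filter _ _)) => e e0; have [r r0 hr] := uniform_continuity_segment cphi e0.
rewrite nearE /within /=; apply/nbhs_ballP; exists r => //= t' tt'.
rewrite in_itv/= => t'T.
have Jt := J_integrable tT; have Jt' := J_integrable t'T.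
have JB := integrable_subr measurableT Jt Jt'.
rewrite -(RintegralB measurableT Jt Jt').
apply: (le_trans (le_normr_Rintegral measurableT JB)).
have P1 : fine (P setT) = 1 by rewrite probability_setT.
have -> : e = \int[P]_w e by rewrite Rintegral_cst// P1 mulr1.
apply: le_Rintegral => //.
- exact: integrable_norm JB.
- exact: finite_measure_integrable_cst.
- move=> w _; apply: (intL_dist T0 hL T00 (left_limit0 _)); [exact: cshift..|].
  move=> s sT; apply: hr; [exact: shift_itv|exact: shift_itv|].
  by rewrite (_ : t - s - (t' - s) = t - t'); [rewrite ltW|ring].
Qed.

Lemma obstacle_continuous (d : nat) (h : R -> 'rV[R]_d -> R -> R) (X : R -> 'rV[R]_d)
    (kappa : R -> R) :
  {within [set p : R * 'rV[R]_d * R | 0 <= p.1.1 <= T],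
     continuous (fun p => h p.1.1 p.1.2 p.2)} ->
  {within `[0, T], continuous X} -> {within `[0, T], continuous kappa} ->
  {within `[0, T], continuous (fun s => h s (X s) (kappa s))}.
Proof.
move=> /subspace_continuousP ch /subspace_continuousP cX /subspace_continuousP ck.
apply/subspace_continuousP => s sT.
have sT' : 0 <= s <= T by move: sT; rewrite /= in_itv.
pose q s : R * 'rV[R]_d * R := (s, X s, kappa s).
have cq : q s' @[s' --> within `[0, T] (nbhs s)] --> nbhs (q s).
  have FF : Filter (within `[0, T]%classic (nbhs s)) by exact: within_filter.
  have c1 : s' @[s' --> within `[0, T] (nbhs s)] --> s by exact: cvg_within.
  exact: cvg_pair (cvg_pair c1 (cX s sT)) (ck s sT).
have cqA : q s' @[s' --> within `[0, T] (nbhs s)] -->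
    within [set p : R * 'rV[R]_d * R | 0 <= p.1.1 <= T] (nbhs (q s)).
  move=> U /cq; rewrite /nbhs /= /within /=; apply: filterS => s' h' s'T.
  by apply: h' => //; move: s'T; rewrite /= in_itv.
exact: (cvg_comp _ _ cqA (ch (q s) sT')).
Qed.

End ObstacleContinuity.

(** * Optimality *)

Section AlmostEverywhere.
Context {R : realType} {dO : measure_display} {O : measurableType dO}.
Variable P : probability O R.

Import HBNNSimple.

(* The supremum bounding an S^2 process need not be measurable, hence no
   measurability assumption. *)
Lemma ge0_le_integral_nonmeasurable (f g : O -> \bar R) : (forall w, (0 <= f w)%E) ->
  (forall w, (f w <= g w)%E) -> (\int[P]_w f w <= \int[P]_w g w)%E.
Proof.
move=> f0 fg; have g0 w : (0 <= g w)%E by exact: le_trans (f0 w) (fg w).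
rewrite !ge0_integralTE//; apply: ereal_sup_le => _ [h hf <-].
by exists h => // w; exact: le_trans (hf w) (fg w).
Qed.

Lemma S2_sq_integrable (T : R) (G : R -> set (set O)) (Y : R -> O -> R) (t : R) :
  G t `<=` measurable -> 0 <= t <= T -> S2 P T G Y -> sq_integrable P (Y t).
Proof.
move=> Gm tT [aY _ Y2]; apply: sq_integrableP.
  exact: sub_sigma_measurable_fun Gm (aY t tT).
apply: le_lt_trans Y2; apply: ge0_le_integral_nonmeasurable => w.
  by rewrite lee_fin sqr_ge0.
by apply: ereal_sup_ubound; exists t => //=; rewrite in_itv.
Qed.

(** Meant for the payoff, whose measurability is not given: on a complete space, a.s. equality with
    an integrable variable supplies it. *)
Lemma ae_integrable_Rintegral (U V : O -> R) : measure_is_complete P ->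
  {ae P, forall w, U w = V w} -> P.-integrable setT (EFin \o V) ->
  P.-integrable setT (EFin \o U) /\
  forall B, measurable B -> \int[P]_(w in B) U w = \int[P]_(w in B) V w.
Proof.
move=> cP UV Vi; have mV := measurable_int P Vi.
have VU : ae_eq P setT (EFin \o V) (EFin \o U).
  by apply: filterS UV => w /= UVw _; rewrite UVw.
have mU := ae_measurable_fun cP VU mV.
have absVU : ae_eq P setT (fun w => `|(V w)%:E|)%E (fun w => `|(U w)%:E|)%E.
  by apply: filterS UV => w /= -> _.
split.
  apply/integrableP; split => //.
  have mabs (Q : O -> R) : measurable_fun setT (EFin \o Q) ->
      measurable_fun setT (fun w => `|(Q w)%:E|)%E.
    exact: measurableT_comp (@abse_measurable R setT).
  rewrite -(ae_eq_integral _ _ measurableT (mabs _ mV) (mabs _ mU) absVU).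
  by case/integrableP : Vi.
move=> B mB; congr fine; apply: ae_eq_integral => //.
- exact: measurable_funS mU.
- exact: measurable_funS mV.
- by apply: filterS UV => w /= -> _.
Qed.

Lemma ae_eq0_of_le0 (S : O -> R) : P.-integrable setT (EFin \o S) ->
  {ae P, forall w, S w <= 0} -> \int[P]_w S w = 0 ->
  {ae P, forall w, S w = 0}.
Proof.
move=> Si S0 IS.
have mS := measurable_int P Si.
have mNS := measurable_int P (integrable_oppr measurableT Si).
have mabs : measurable_fun setT (fun w => `|(S w)%:E|)%E.
  exact: measurableT_comp (@abse_measurable R setT) mS.
have absE : ae_eq P setT (fun w => `|(S w)%:E|)%E (EFin \o (fun w => - S w)).
  by apply: filterS S0 => w /= Sw _; rewrite ler0_norm.
have : (\int[P]_w `|(S w)%:E| = 0)%E.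
  rewrite (ae_eq_integral _ _ measurableT mabs mNS absE).
  rewrite -[LHS]fineK; last by apply: integrable_fin_num => //; exact: integrable_oppr.
  congr EFin; rewrite -/(Rintegral _ _ _).
  under eq_Rintegral do rewrite -mulN1r.
  by rewrite RintegralZl// IS mulr0.
move/(ae_eq_integral_abs P measurableT mS); apply: filterS => w /= /(_ I) [].
by [].
Qed.

End AlmostEverywhere.

(** * The stochastic integral integrated against a path of V *)

Section MartingaleAgainstStopping.
Context {R : realType} {dO : measure_display} {O : measurableType dO}.
Context {d m : nat}.
Variables (P : probability O R) (T : R) (W : R -> O -> 'rV[R]_m).
Variable X0 : O -> 'rV[R]_d.
Hypotheses (T0 : 0 < T).
Hypotheses (hP : measure_is_complete P) (hW : brownian_motion P T W).
Hypotheses (hX0 : measurable_fun setT X0).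
Hypothesis hindep : indep P (preimage_set_system setT X0 measurable) <<s past W T>>.
Local Notation G := (filtration P W X0).
Variables (Z : R -> O -> 'rV[R]_m) (M : R -> O -> R) (L : R -> O -> R).
Hypotheses (hM : is_ito P T G W Z M) (hL : in_V T G L).

(* Summation by parts writes this integral as a limit of martingale transforms
   of M with integrand -L, which are bounded in L^2 since |L| <= 1. *)
Lemma ito_intL (t : R) : 0 <= t <= T ->
  let N w := intL T t (fun s => M s w - M t w) (fun s => L s w) in
  sq_integrable P N /\ forall B, <<s G t>> B -> \int[P]_(w in B) N w = 0.
Proof.
move=> tT N; case/andP: (tT) => t0 tT'.
have [_ aM cM _] := hM.
(* The grid is continued by the constant T beyond its last index, because martingale transforms are
   set up for sequences indexed by all natural numbers. *)
pose s n i := grid t T n.+1 (minn i n.+1).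
have sI n i : t <= s n i <= T by apply: grid_itv => //; exact: geq_minr.
have sI0 n i : 0 <= s n i <= T.
  by have /andP[ts ->] := sI n i; rewrite (le_trans t0 ts).
have sle n i : s n i <= s n i.+1 by apply: grid_le => //; rewrite leq_min geq_minr andbT (leq_trans (geq_minl _ _)).
have sT n i : s n i <= T by case/andP: (sI n i).
have sn0 n i : 0 <= s n i by case/andP: (sI0 n i).
have s0 n : s n 0 = t by rewrite /s min0n grid0.
have sn n : s n n.+1 = T by rewrite /s minnn gridnn.
have M2 u : 0 <= u <= T -> sq_integrable P (M u).
  exact: (ito_sq_integrable hP hW hX0 hM).
pose X n w := \sum_(i < n.+1) - L (s n i) w * (M (s n i.+1) w - M (s n i) w).
have Hm n i : G (s n i) `<=` measurable by exact: (filtration_measurable hP hW hX0).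
have HS n i : <<s G (s n i)>> `<=` <<s G (s n i.+1)>> by exact: filtration_le.
have Mad n i := aM _ (sI0 n i).
have Msq n i := M2 _ (sI0 n i).
have Mce n i : centered P (G (s n i)) (fun w => M (s n i.+1) w - M (s n i) w).
  exact: (ito_centered hP hW hX0 hindep hM).
have Lad n i : measurable_fun setT
    ((fun w => - L (s n i) w) : g_sigma_algebraType (G (s n i)) -> R).
  exact: measurableT_comp (@oppr_measurable R setT) (V_adapted hL (sI0 n i)).
have L1 n i w : `|- L (s n i) w| <= 1.
  by rewrite normrN; have /andP[? ?] := V_range hL w (sI0 n i); rewrite ger0_norm.
have X2 n : sq_integrable P (X n).
  exact: (@martingale_transform_sq_integrable _ _ _ _ (fun i => G (s n i))
    (fun i => M (s n i)) (fun i w => - L (s n i) w) (Hm n) (Msq n) (Lad n) (L1 n)).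
have XC n : \int[P]_w (X n w ^+ 2) <= \int[P]_w ((M T w - M t w) ^+ 2).
  have := @martingale_transform_le _ _ _ _ (fun i => G (s n i)) (fun i => M (s n i))
    (fun i w => - L (s n i) w) (Hm n) (HS n) (Mad n) (Msq n) (Mce n) (Lad n) (L1 n) n.+1.
  by rewrite sn s0.
have X_cvg w : X n w @[n --> \oo] --> N w.
  have cMt : {within `[t, T], continuous (fun u => M u w - M t w)}.
    have sub : (`[t, T]%classic : set R) `<=` `[0, T].
      by apply: subset_itvr; rewrite bnd_simp.
    move=> u; apply: cvgB; last exact: cvg_cst.
    exact: (continuous_subspaceW sub (cM w)).
  have lim := cvg_intL_martingale T0 hL tT cMt (subrr _).
  rewrite (_ : (fun n => X n w) = (fun n => - (\sum_(i < n.+1) L (grid t T n.+1 i) w *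
    ((M (grid t T n.+1 i.+1) w - M t w) - (M (grid t T n.+1 i) w - M t w))))); first exact: lim.
  apply/funext => n; rewrite /X -sumrN; apply: eq_bigr => i _.
  by rewrite /s (minn_idPl (ltn_ord i)) (minn_idPl (ltnW (ltn_ord i))); ring.
split; first exact: (bounded_cvg_sq_integrable X2 XC X_cvg).
move=> B HB; have mB := sub_sigma_measurable (filtration_measurable hP hW hX0 tT') HB.
apply: (bounded_cvg_Rintegral0 X2 XC X_cvg mB) => n.
have [_] := @martingale_transform_centered _ _ _ _ (fun i => G (s n i)) (fun i => M (s n i))
  (fun i w => - L (s n i) w) (Hm n) (HS n) (Msq n) (Mce n) (Lad n) (L1 n) n.+1.
by apply; rewrite s0.
Qed.

End MartingaleAgainstStopping.

Theorem theorem3p3 (R : realType) (T : R) (hT : 0 < T)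
  (d k m : nat) (hd : (1 <= d)%N) (hk : (1 <= k)%N) (hm : (1 <= m)%N)
  (q : R) (hq : 4 <= q)
  (dO : measure_display) (O : measurableType dO) (P : probability O R)
  (hP : measure_is_complete P)
  (W : R -> O -> 'rV[R]_m) (hW : brownian_motion P T W)
  (X0 : O -> 'rV[R]_d) (hX0 : measurable_fun setT X0)
  (hindep : indep P (preimage_set_system setT X0 measurable) <<s past W T>>)
  (hX0q : (\int[P]_w (enorm (X0 w) `^ q)%:E < +oo)%E)
  (D : coefficients R d k m) (hD : measurable_data T D)
  (hF : forward_lipschitz T D) (hB : backward_regular T D q)
  (L : R -> O -> R) (hL : in_V T (filtration P W X0) L)
  (X : R -> O -> 'rV[R]_d) (hX : forward_solution P T W X0 D L X)
  (Y : R -> O -> R) (Z : R -> O -> 'rV[R]_m) (A : R -> O -> R)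
  (hYZA : rbsde_solution P T W X0 D L X Y Z A)
  (t : R) (ht : 0 <= t <= T)
  (hrep : is_ess_sup P
    [set V | exists2 L', in_Vt P T (filtration P W X0) t L' &
               is_Lambda P T W X0 D L X t L' V]
    (Y t))
  (Lhat : R -> O -> R) (hLhat : in_Vt P T (filtration P W X0) t Lhat) :
  is_Lambda P T W X0 D L X t Lhat (Y t) <->
  {ae P, forall w,
    intL T t (fun s => Y s w - xi P T D L X s w) (fun s => Lhat s w) = 0} /\
  {ae P, forall w,
    intL T t (fun s => A s w - A t w) (fun s => Lhat s w) = 0}.
Proof.
set G := filtration P W X0 in hL hLhat *.
have Gm s : 0 <= s <= T -> G s `<=` measurable.
  by move=> /andP[_ sT]; exact: (filtration_measurable hP hW hX0 sT).
have Gmt := Gm t ht.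
have [hYZA_Y _ hYZA_A [M hM eqY] obstacle _] := hYZA.
have [hLhatV Lhat1] := hLhat.
pose N w := intL T t (fun s => M s w - M t w) (fun s => Lhat s w).
pose I1 w := intL T t (fun s => Y s w - xi P T D L X s w) (fun s => Lhat s w).
pose I2 w := intL T t (fun s => A s w - A t w) (fun s => Lhat s w).
pose U := payoff P T D L X t Lhat.
have [N2 N0] := ito_intL hT hP hW hX0 hindep hM hLhatV ht.
have Y2 := S2_sq_integrable Gmt ht hYZA_Y.
have Ni := sq_integrable_integrable N2.
have Yi := sq_integrable_integrable Y2.
(* With continuous obstacle paths, all the integrands against - d Lhat below are continuous, hence
   integrable, and the integrals can be added. *)
have cxi w : {within `[0, T], continuous (fun s => xi P T D L X s w)}.
  apply: obstacle_continuous.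
  - by case: hB => _ [].
  - by case: hX => -[_ cX _] _; exact: cX.
  - apply: (expected_intL_continuous hT hL Gm).
    by case: hB => _ [_]; exact: C1_on_continuous.
have decomposition : {ae P, forall w, U w = Y t w + I1 w + I2 w - N w}.
  move: Lhat1 eqY; apply: filterS2 => w left1 [fi Yeq].
  apply: (payoff_decomposition hT hLhatV ht left1 fi) => //.
  - by case: hYZA_Y => _ cY _; exact: cY.
  - by case: hYZA_A => -[_ cA _] _ _; exact: cA.
  - by case: hM => _ _ cM _; exact: cM.
  - exact: Yeq.
have tI s : t <= s <= T -> 0 <= s <= T.
  by case/andP: ht => t0 _ /andP[ts ->]; rewrite (le_trans t0).
have I1_le0 : {ae P, forall w, I1 w <= 0}.
  apply: filterS obstacle => w ob.
  by apply: intL_le0 => r /tI rT; rewrite subr_ge0; exact: ob.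
have I2_le0 w : I2 w <= 0.
  apply: intL_le0 => s /andP[ts sT]; rewrite subr_ge0.
  by case: hYZA_A => _ ndA _; apply: ndA => //; case/andP: ht.
have GT : <<s G t>> setT by exact: (@measurableT _ (g_sigma_algebraType (G t))).
split.
- move=> [Ui _ _ UE].
  have UYi := integrable_subr measurableT Ui Yi.
  (* This combination is a.s. the sum of [I1] and [I2], and its integrability comes from its three
     terms. *)
  have Si := integrable_addr measurableT UYi Ni.
  have SE : {ae P, forall w, U w - Y t w + N w = I1 w + I2 w}.
    by apply: filterS decomposition => w ->; ring.
  have S_le0 : {ae P, forall w, U w - Y t w + N w <= 0}.
    move: SE I1_le0; apply: filterS2 => w -> I1w.
    by rewrite -(addr0 0) lerD.
  (* The defining property of the conditional expectation and the centering of [N] are both taken at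
     the whole space. *)
  have IS : \int[P]_w (U w - Y t w + N w) = 0.
    rewrite (RintegralD measurableT UYi Ni) (RintegralB measurableT Ui Yi).
    by rewrite (N0 _ GT) (UE _ GT) subrr addr0.
  have S_0 := ae_eq0_of_le0 Si S_le0 IS.
  split.
  + move: SE S_0 I1_le0; apply: filterS3 => w -> S0 I1w.
    by apply/eqP; rewrite eq_le I1w/=; have := I2_le0 w; lra.
  + move: SE S_0 I1_le0; apply: filterS3 => w -> S0 I1w.
    by apply/eqP; rewrite eq_le (I2_le0 w)/=; lra.
- move=> [I1_0 I2_0].
  have UE : {ae P, forall w, U w = Y t w - N w}.
    move: decomposition I1_0 I2_0; apply: filterS3 => w ->.
    by rewrite -/(I1 w) -/(I2 w) => -> ->; rewrite !addr0.
  have YNi := integrable_subr measurableT Yi Ni.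
  (* The payoff inherits integrability and its integrals from [Y t - N]. Over sets of F_t those of
     [N] vanish, so [Y t], being adapted, is a version of the conditional expectation. *)
  have [Ui UB] := ae_integrable_Rintegral hP UE YNi.
  split => //; first by case: hYZA_Y => aY _ _; exact: aY.
  move=> B GB; have mB := sub_sigma_measurable Gmt GB.
  have YB := integrableS measurableT mB (@subsetT _ B) Yi.
  have NB := integrableS measurableT mB (@subsetT _ B) Ni.
  by rewrite (UB B mB) (RintegralB mB YB NB) (N0 _ GB) subr0.
Qed.
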